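(* Let $R$ be a commutative noetherian ring, let $C$ be a semidualizing $R$-module, let $M$ be an $R$-module, and let $M'\subseteq M$ be a pure submodule. Then one has $$\mathcal{F}_C\text{-}\operatorname{pd}_R(M)\geq\sup\{\mathcal{F}_C\text{-}\operatorname{pd}_R(M'),\ \mathcal{F}_C\text{-}\operatorname{pd}_R(M/M')-1\}.$$
   Context: $R$ is a commutative noetherian ring. A finitely generated $R$-module $C$ is semidualizing if the homothety map $R\to\operatorname{Hom}_R(C,C)$ is an isomorphism and $\operatorname{Ext}^i_R(C,C)=0$ for all $i\geq 1$. $\mathcal{F}_C(R)$ is the class of $R$-modules isomorphic to $F\otimes_R C$ with $F$ flat; it is precovering. A proper $\mathcal{F}_C$-resolution of $M$ is a complex $X=(\cdots\to X_1\to X_0\to 0)$ with each $X_i\in\mathcal{F}_C(R)$ together with an augmentation $X_0\to M$ such that $X^+=(\cdots\to X_1\to X_0\to M\to 0)$ is a complex (not necessarily exact) and $\operatorname{Hom}_R(Y,X^+)$ is exact for all $Y\in\mathcal{F}_C(R)$. Set $$\mathcal{F}_C\text{-}\operatorname{pd}_R(M)=\inf\{\sup\{n\mid X_n\neq 0\}\mid X\text{ is a proper }\mathcal{F}_C\text{-resolution of }M\},$$ with $\mathcal{F}_C\text{-}\operatorname{pd}_R(0)=-\infty$. A submodule $M'\subseteq M$ is pure if for every $R$-module $N$ the induced map $N\otimes_R M'\to N\otimes_R M$ is injective. *)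

(* Defs.v *)
From HB Require Import structures.
From mathcomp Require Import all_boot all_order all_algebra.
From mathcomp Require Import boolp classical_sets constructive_ereal ereal.
From mathcomp Require Import Rstruct.

Set Implicit Arguments.
Unset Strict Implicit.
Unset Printing Implicit Defensive.

Import GRing.Theory.
Local Open Scope ring_scope.
Local Open Scope quotient_scope.

Section SubmoduleAndQuotient.
Context (R : comPzRingType) (M : lmodType R) (S : submodClosed M).

Record submod : Type := Submod { submod_val : M; _ : submod_val \in S }.

HB.instance Definition _ := [isSub of submod for submod_val].
HB.instance Definition _ := [Choice of submod by <:].
HB.instance Definition _ := [SubChoice_isSubLmodule of submod by <:].

Definition submod_incl : submod -> M := val.
HB.instance Definition _ := GRing.Linear.on submod_incl.

Definition quot_rel (x y : M) : bool := x - y \in S.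

Let SN x : x \in S -> - x \in S.
Proof. by rewrite -scaleN1r; apply: rpredZ. Qed.

Lemma quot_rel_equiv : equiv_class_of quot_rel.
Proof.
split=> [x | x y | y x z]; rewrite /quot_rel.
- by rewrite subrr rpred0.
- by apply/idP/idP=> /SN; rewrite opprB.
- by move=> xy yz; rewrite -(subrK y x) -addrA rpredD.
Qed.

Canonical quot_equiv := EquivRelPack quot_rel_equiv.

Definition quotmod : Type := {eq_quot quot_rel}.

HB.instance Definition _ := Choice.on quotmod.
HB.instance Definition _ := EqQuotient.on quotmod.

Lemma quotmodP (x y : M) : \pi_quotmod x = \pi_quotmod y <-> x - y \in S.
Proof. by split=> [/eqquotP|?]; last apply/eqquotP. Qed.

Let piW (P : quotmod -> Prop) : (forall x, P (\pi_quotmod x)) -> forall u, P u.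
Proof. by move=> Px u; rewrite -[u]reprK. Qed.

Let repr_pi x : repr (\pi_quotmod x) - x \in S.
Proof. by apply/quotmodP; rewrite reprK. Qed.

Let add (u v : quotmod) : quotmod := \pi_quotmod (repr u + repr v).
Let opp (u : quotmod) : quotmod := \pi_quotmod (- repr u).
Let scale (a : R) (u : quotmod) : quotmod := \pi_quotmod (a *: repr u).

Let addE x y : add (\pi_quotmod x) (\pi_quotmod y) = \pi_quotmod (x + y).
Proof. by apply/quotmodP; rewrite opprD addrACA rpredD ?repr_pi. Qed.

Let oppE x : opp (\pi_quotmod x) = \pi_quotmod (- x).
Proof. by apply/quotmodP; rewrite -opprD SN ?repr_pi. Qed.

Let scaleE a x : scale a (\pi_quotmod x) = \pi_quotmod (a *: x).
Proof. by apply/quotmodP; rewrite -scalerBr rpredZ ?repr_pi. Qed.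

Let addA : associative add.
Proof. by elim/piW=> x; elim/piW=> y; elim/piW=> z; rewrite !addE addrA. Qed.
Let addC : commutative add.
Proof. by elim/piW=> x; elim/piW=> y; rewrite !addE addrC. Qed.
Let add0 : left_id (\pi_quotmod 0) add.
Proof. by elim/piW=> x; rewrite addE add0r. Qed.
Let addN : left_inverse (\pi_quotmod 0) opp add.
Proof. by elim/piW=> x; rewrite oppE addE addNr. Qed.

HB.instance Definition _ := GRing.isZmodule.Build quotmod addA addC add0 addN.

Let scaleA a b u : scale a (scale b u) = scale (a * b) u.
Proof. by elim/piW: u => x; rewrite !scaleE scalerA. Qed.
Let scale1 : left_id 1 scale.
Proof. by elim/piW=> x; rewrite scaleE scale1r. Qed.
Let scaleDr : right_distributive scale +%R.
Proof.
move=> a; elim/piW=> x; elim/piW=> y.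
by rewrite [_ + _]addE !scaleE [RHS]addE scalerDr.
Qed.
Let scaleDl u : {morph scale^~ u : a b / a + b}.
Proof. by elim/piW: u => x a b; rewrite !scaleE [RHS]addE scalerDl. Qed.

HB.instance Definition _ :=
  GRing.Zmodule_isLmodule.Build R quotmod scaleA scale1 scaleDr scaleDl.

Definition quotmod_proj (x : M) : quotmod := \pi_quotmod x.

Lemma quotmod_proj_linear : linear quotmod_proj.
Proof.
by move=> a x y; rewrite /quotmod_proj [a *: \pi_quotmod x]scaleE [RHS]addE.
Qed.

HB.instance Definition _ :=
  GRing.isLinear.Build R M quotmod _ quotmod_proj quotmod_proj_linear.

End SubmoduleAndQuotient.

Arguments submod {R M} S.
Arguments quotmod {R M} S.

(* [{bilinear _ -> _ -> _}] is only available over nonzero rings. *)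
Definition is_bilinear (R : comPzRingType) (M N P : lmodType R)
    (b : M -> N -> P) : Prop :=
  (forall x, linear (b x)) /\ (forall y, linear (b^~ y)).

Section Tensor.
Context (R : comPzRingType) (M N : lmodType R).

(* A list [:: (x1, y1); ...; (xn, yn)] stands for the formal sum of the
   symbols xi (x) yi.  Inverses need no generator: (- x, y) is opposite to
   (x, y) by additivity and [tens_0]. *)
Inductive tens_rel : seq (M * N) -> seq (M * N) -> Prop :=
| tens_refl s : tens_rel s s
| tens_sym s t : tens_rel s t -> tens_rel t s
| tens_trans t s u : tens_rel s t -> tens_rel t u -> tens_rel s u
| tens_cat s s' t t' :
    tens_rel s s' -> tens_rel t t' -> tens_rel (s ++ t) (s' ++ t')
| tens_comm s t : tens_rel (s ++ t) (t ++ s)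
| tens_0 y : tens_rel [:: (0, y)] [::]
| tens_addl x x' y : tens_rel [:: (x + x', y)] [:: (x, y); (x', y)]
| tens_addr x y y' : tens_rel [:: (x, y + y')] [:: (x, y); (x, y')]
| tens_scale a x y : tens_rel [:: (a *: x, y)] [:: (x, a *: y)].

Definition tens_relb (s t : seq (M * N)) : bool := `[< tens_rel s t >].

Lemma tens_rel_equiv : equiv_class_of tens_relb.
Proof.
split=> [s | s t | t s u].
- exact/asboolP/tens_refl.
- by apply/asbool_equiv_eq; split; apply: tens_sym.
- by move=> /asboolP st /asboolP tu; apply/asboolP/(tens_trans st tu).
Qed.

Canonical tens_equiv := EquivRelPack tens_rel_equiv.

Definition tensor : Type := {eq_quot tens_relb}.

HB.instance Definition _ := Choice.on tensor.
HB.instance Definition _ := EqQuotient.on tensor.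

Lemma tensorP (s t : seq (M * N)) :
  \pi_tensor s = \pi_tensor t <-> tens_rel s t.
Proof. by split=> [/eqquotP/asboolP|?]; last exact/eqquotP/asboolP. Qed.

Let piW (P : tensor -> Prop) : (forall x, P (\pi_tensor x)) -> forall u, P u.
Proof. by move=> Px u; rewrite -[u]reprK. Qed.

Let repr_pi s : tens_rel (repr (\pi_tensor s)) s.
Proof. by apply/tensorP; rewrite reprK. Qed.

Let scales (a : R) (s : seq (M * N)) := [seq (a *: p.1, p.2) | p <- s].

Let scales_rel a s t : tens_rel s t -> tens_rel (scales a s) (scales a t).
Proof.
elim=> {s t}.
- by move=> s; apply: tens_refl.
- by move=> s t _; apply: tens_sym.
- by move=> t s u _ st _; apply: tens_trans.
- by move=> s s' t t' _ ss' _ tt'; rewrite /scales !map_cat; apply: tens_cat.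
- by move=> s t; rewrite /scales !map_cat; apply: tens_comm.
- by move=> y; rewrite /= scaler0; apply: tens_0.
- by move=> x x' y; rewrite /= scalerDr; apply: tens_addl.
- by move=> x y y'; apply: tens_addr.
- by move=> b x y; rewrite /= scalerA mulrC -scalerA; apply: tens_scale.
Qed.

Let add (u v : tensor) : tensor := \pi_tensor (repr u ++ repr v).
Let opp (u : tensor) : tensor := \pi_tensor (scales (-1) (repr u)).
Let scale (a : R) (u : tensor) : tensor := \pi_tensor (scales a (repr u)).

Let addE s t : add (\pi_tensor s) (\pi_tensor t) = \pi_tensor (s ++ t).
Proof. by apply/tensorP/tens_cat; apply: repr_pi. Qed.
Let oppE s : opp (\pi_tensor s) = \pi_tensor (scales (-1) s).
Proof. exact/tensorP/scales_rel/repr_pi. Qed.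
Let scaleE a s : scale a (\pi_tensor s) = \pi_tensor (scales a s).
Proof. exact/tensorP/scales_rel/repr_pi. Qed.

Let addA : associative add.
Proof. by elim/piW=> x; elim/piW=> y; elim/piW=> z; rewrite !addE catA. Qed.
Let addC : commutative add.
Proof.
by elim/piW=> x; elim/piW=> y; rewrite !addE; apply/tensorP/tens_comm.
Qed.
Let add0 : left_id (\pi_tensor [::]) add.
Proof. by elim/piW=> x; rewrite addE. Qed.

Let scalesDl a b s : tens_rel (scales (a + b) s) (scales a s ++ scales b s).
Proof.
elim: s => [|[x y] s IHs] /=; first exact: tens_refl.
apply: (tens_trans (t := [:: (a *: x, y); (b *: x, y)]
                           ++ (scales a s ++ scales b s))).
  by rewrite -cat1s scalerDl; apply: tens_cat => //; apply: tens_addl.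
have -> : (a *: x, y) :: scales a s ++ (b *: x, y) :: scales b s =
          ([:: (a *: x, y)] ++ (scales a s ++ [:: (b *: x, y)])) ++ scales b s.
  by rewrite /= -catA.
have -> : [:: (a *: x, y); (b *: x, y)] ++ (scales a s ++ scales b s) =
    ([:: (a *: x, y)] ++ ([:: (b *: x, y)] ++ scales a s)) ++ scales b s by [].
apply: tens_cat (tens_refl _); apply: tens_cat (tens_refl _) _.
exact: tens_comm.
Qed.

Let scales0 s : tens_rel (scales 0 s) [::].
Proof.
elim: s => [|[x y] s IHs] /=; first exact: tens_refl.
rewrite scale0r -[_ :: _]cat1s -[[::]](cats0 [::]).
by apply: tens_cat => //; apply: tens_0.
Qed.

Let scales1 s : scales 1 s = s.
Proof. by rewrite /scales -[RHS]map_id; apply: eq_map => -[x y] /=; rewrite scale1r. Qed.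

Let addN : left_inverse (\pi_tensor [::]) opp add.
Proof.
elim/piW=> s; rewrite oppE addE; apply/tensorP.
rewrite -[X in _ ++ X]scales1; apply: tens_trans (scales0 s).
by rewrite -(addNr 1); apply/tens_sym/scalesDl.
Qed.

HB.instance Definition _ := GRing.isZmodule.Build tensor addA addC add0 addN.

Let scaleA a b u : scale a (scale b u) = scale (a * b) u.
Proof.
elim/piW: u => s; rewrite !scaleE /scales -map_comp; congr (\pi_tensor _).
by apply: eq_map => -[x y] /=; rewrite scalerA.
Qed.
Let scale1 : left_id 1 scale.
Proof. by elim/piW=> s; rewrite scaleE scales1. Qed.
Let scaleDr : right_distributive scale +%R.
Proof.
move=> a; elim/piW=> x; elim/piW=> y.
by rewrite [_ + _]addE !scaleE [RHS]addE /scales map_cat.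
Qed.
Let scaleDl u : {morph scale^~ u : a b / a + b}.
Proof.
elim/piW: u => s a b; rewrite !scaleE [RHS]addE.
exact/tensorP/scalesDl.
Qed.

HB.instance Definition _ :=
  GRing.Zmodule_isLmodule.Build R tensor scaleA scale1 scaleDr scaleDl.

Definition tens (x : M) (y : N) : tensor := \pi_tensor [:: (x, y)].

Lemma tens_bilinear : is_bilinear tens.
Proof.
split=> [x | y] a u v; rewrite /tens [a *: \pi_tensor _]scaleE [RHS]addE; apply/tensorP.
  apply: tens_trans (tens_addr _ _ _) _.
  rewrite -[X in tens_rel X]cat1s -[X in tens_rel _ X]cat1s.
  by apply: tens_cat; [apply/tens_sym/tens_scale | apply: tens_refl].
exact: tens_addl.
Qed.

Lemma tensorE s : \pi_tensor s = \sum_(p <- s) tens p.1 p.2.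
Proof.
elim: s => [|[x y] s IHs]; first by rewrite big_nil.
by rewrite big_cons -IHs [RHS]addE.
Qed.

Section Lift.
Context (P : lmodType R) (b : M -> N -> P) (b_bil : is_bilinear b).

Definition tens_lift of is_bilinear b : tensor -> P :=
  fun u => \sum_(p <- repr u) b p.1 p.2.

Let b0l y : b 0 y = 0.
Proof.
by move: (b_bil.2 y 1 0 0); rewrite scale1r addr0 scale1r -[LHS]addr0 => /addrI.
Qed.

Let sum_rel s t : tens_rel s t ->
  \sum_(p <- s) b p.1 p.2 = \sum_(p <- t) b p.1 p.2.
Proof.
case: b_bil => br bl; elim=> {s t} //.
- by move=> t s u _ -> _ ->.
- by move=> s s' t t' _ ss' _ tt'; rewrite !big_cat /= ss' tt'.
- by move=> s t; rewrite !big_cat /= addrC.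
- by move=> y; rewrite big_seq1 big_nil b0l.
- move=> x x' y; rewrite !big_cons !big_nil !addr0 /=.
  by move: (bl y 1 x x'); rewrite !scale1r.
- move=> x y y'; rewrite !big_cons !big_nil !addr0 /=.
  by move: (br x 1 y y'); rewrite !scale1r.
- move=> a x y; rewrite !big_seq1 /=.
  have br0 : b x 0 = 0.
    by move: (br x 1 0 0); rewrite scale1r addr0 scale1r -[LHS]addr0 => /addrI.
  move: (br x a y 0) (bl y a x 0); rewrite !addr0 b0l br0 !addr0.
  by move=> -> ->.
Qed.

Lemma tens_lift_pi s : tens_lift b_bil (\pi_tensor s) = \sum_(p <- s) b p.1 p.2.
Proof. exact/sum_rel/repr_pi. Qed.

Lemma tens_lift_linear : linear (tens_lift b_bil).
Proof.
move=> a; elim/piW=> s; elim/piW=> t.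
rewrite [a *: \pi_tensor s]scaleE [_ + \pi_tensor t]addE !tens_lift_pi big_cat /=.
congr (_ + _); rewrite big_map scaler_sumr; apply: eq_bigr => p _ /=.
by move: (b_bil.2 p.2 a p.1 0); rewrite !addr0 b0l addr0.
Qed.

HB.instance Definition _ :=
  GRing.isLinear.Build R tensor P _ (tens_lift b_bil) tens_lift_linear.

Lemma tens_liftE x y : tens_lift b_bil (tens x y) = b x y.
Proof. by rewrite tens_lift_pi big_seq1. Qed.

Lemma tens_lift_uniq (g : {linear tensor -> P}) :
  (forall x y, g (tens x y) = b x y) -> g =1 tens_lift b_bil.
Proof.
move=> gE; elim/piW=> s; rewrite tens_lift_pi tensorE linear_sum.
by apply: eq_bigr => p _; apply: gE.
Qed.

End Lift.

End Tensor.

Section TensorMap.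
Context (R : comPzRingType) (N A B : lmodType R) (f : {linear A -> B}).

Lemma tens_map_bilinear : is_bilinear (fun (n : N) (a : A) => tens n (f a)).
Proof.
case: (tens_bilinear N B) => tr tl; split=> [n | a] c u v.
  by rewrite linearP tr.
exact: tl.
Qed.

(* N (x) f : N (x) A -> N (x) B *)
Definition tens_map : tensor N A -> tensor N B := tens_lift tens_map_bilinear.
HB.instance Definition _ := GRing.Linear.on tens_map.

End TensorMap.
Arguments tens_map {R} N {A B} f.

Section ModuleProperties.
Context (R : comPzRingType).
Implicit Types (A B C M N F P X Y : lmodType R).

Definition fingen M : Prop :=
  exists s : seq M, forall x, exists c : 'I_(size s) -> R,
    x = \sum_(i < size s) c i *: s`_i.

Definition noetherian : Prop := forall I : submodClosed R^o, fingen (submod I).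

Definition isomorphic M N : Prop := exists f : {linear M -> N}, bijective f.

Definition flat F : Prop :=
  forall A B (f : {linear A -> B}), injective f -> injective (tens_map F f).

Definition projective P : Prop :=
  forall A B (g : {linear A -> B}) (f : {linear P -> B}),
    (forall y, exists x, g x = y) ->
    exists h : {linear P -> A}, forall x, g (h x) = f x.

Record proj_resolution A := ProjResolution {
  pr_obj :> nat -> lmodType R;
  pr_d : forall n, {linear pr_obj n.+1 -> pr_obj n};
  pr_aug : {linear pr_obj 0%N -> A};
  pr_proj : forall n, projective (pr_obj n);
  pr_aug_surj : forall a, exists x, pr_aug x = a;
  pr_exact0 : forall x, pr_aug x = 0 <-> exists y, pr_d 0%N y = x;
  pr_exact : forall n x, pr_d n x = 0 <-> exists y, pr_d n.+1 y = x
}.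

(* The i-th cohomology of Hom(P, B) vanishes: every cocycle P_i -> B is a
   coboundary.  As Ext^i(A, B) does not depend on the projective resolution
   up to isomorphism, the vanishing is required for all of them. *)
Definition Ext_eq0 (i : nat) A B : Prop :=
  forall (P : proj_resolution A) (f : {linear P i -> B}),
    (forall x, f (pr_d P i x) = 0) ->
    match i return {linear P i -> B} -> Prop with
    | 0 => fun f => forall x, f x = 0
    | j.+1 => fun f => exists g : {linear P j -> B}, forall x, f x = g (pr_d P j x)
    end f.

Definition semidualizing C : Prop :=
  [/\ fingen C,
      forall f : {linear C -> C}, exists! a : R, f =1 *:%R a
    & forall i : nat, (0 < i)%N -> Ext_eq0 i C C].

Definition pure M (S : submodClosed M) : Prop :=
  forall N, injective (tens_map N (@submod_incl R M S)).

Section FC.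
Context (C : lmodType R).

Definition in_FC X : Prop := exists2 F, flat F & isomorphic X (tensor F C).

Record proper_FC_resolution M := ProperFCResolution {
  fc_obj :> nat -> lmodType R;
  fc_d : forall n, {linear fc_obj n.+1 -> fc_obj n};
  fc_aug : {linear fc_obj 0%N -> M};
  fc_in_FC : forall n, in_FC (fc_obj n);
  fc_d_d : forall n x, fc_d n (fc_d n.+1 x) = 0;
  fc_aug_d : forall x, fc_aug (fc_d 0%N x) = 0;
  fc_proper_aug : forall Y, in_FC Y -> forall f : {linear Y -> M},
    exists g : {linear Y -> fc_obj 0%N}, forall y, fc_aug (g y) = f y;
  fc_proper0 : forall Y, in_FC Y -> forall f : {linear Y -> fc_obj 0%N},
    (forall y, fc_aug (f y) = 0) ->
    exists g : {linear Y -> fc_obj 1%N}, forall y, fc_d 0%N (g y) = f y;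
  fc_proper : forall n Y, in_FC Y -> forall f : {linear Y -> fc_obj n.+1},
    (forall y, fc_d n (f y) = 0) ->
    exists g : {linear Y -> fc_obj n.+2}, forall y, fc_d n.+1 (g y) = f y
}.

Local Open Scope classical_set_scope.
Local Open Scope ereal_scope.

Definition fc_length M (X : proper_FC_resolution M) : \bar Rdefinitions.R :=
  ereal_sup [set n%:R%:E | n in [set n : nat | exists x : X n, x <> 0%R]].

(* ereal_sup set0 = -oo, so the zero complex, which is a proper resolution of
   the zero module, has length -oo, whence FC_pd 0 = -oo; and
   ereal_inf set0 = +oo. *)
Definition FC_pd M : \bar Rdefinitions.R :=
  ereal_inf [set l | exists X : proper_FC_resolution M, l = fc_length X].

End FC.

End ModuleProperties.

(* Main.v *)
From HB Require Import structures.
Require Import Defs.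
From mathcomp Require Import all_boot all_order all_algebra.
From mathcomp Require Import boolp classical_sets constructive_ereal ereal.
From mathcomp Require Import Rstruct.

(** Write [hom C M] for the module of linear maps from [C] to [M]. The
    [F_C]-projective dimension of [M] is the flat dimension of [hom C M], and
    flat dimension behaves well along pure submodules.

    Flat dimension. A pure exact sequence [0 -> N' -> N -> N'' -> 0] has zero
    connecting maps in the long exact sequences of Tor, so that the vanishing
    of [Tor_i(N, -)] passes to both [N'] and [N''] ([tor1_eq0_pure_sub],
    [tor1_eq0_pure_quot]). Only [Tor_1] is ever formed, as the injectivity of
    a map of tensor products; higher Tor modules are reached through syzygies
    of the test module ([flat_dim_leS]).

    From [M] to [hom C M]. As [R] is noetherian, [C] is finitely presented, so
    [hom C -] turns a pure exact sequence into a pure exact sequence: a finite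
    system of linear equations over [hom C M] is a finite system over [M]
    ([hom_post_eq_pure], [hom_post_right_exact]). As [C] is semidualizing and
    finitely presented, [F -> hom C (F (x) C)] is an isomorphism for [F] flat
    ([tens_unit_bij]). Hence [hom C -] carries a proper [F_C]-resolution of [M]
    to a flat resolution of [hom C M] ([proper_flat_dim_lt]), and linear maps
    [G (x) C -> F (x) C] come from linear maps [G -> F] ([tensor_full]).

    From [hom C M] back to [M]. Tensoring a flat resolution [F_n] of
    [hom C M] with [C] gives a proper [F_C]-resolution of [M] provided that
    every map from a flat module to a syzygy lifts to the next [F_n]. So the
    [F_n] have to be flat precovers, and the substantial ingredient is that
    every module has one ([flat_precover]). Such a precover is a direct sum of
    flat modules of bounded size, because each map [G -> N] with [G] flat
    factors through a flat quotient [H] of [G] whose size is bounded in terms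
    of [R] and [N]: divide [G] by a maximal pure submodule of the kernel
    ([flat_factor_bounded]). The bound comes from [unreached_pure_submod]: if
    [H] exceeds it, the kernel of [H -> N] contains a nonzero pure submodule.
    The bound itself is a type of infinitely branching trees, every tree
    being evaluated in [H], and to lie within the bound means that the
    evaluation is surjective.

    Altogether the canonical resolution of [M'] or [M / M'] by precovers is
    no longer than any proper [F_C]-resolution of [M] ([FC_pd_le]). For the
    quotient this is more than the asserted bound. *)

Set Implicit Arguments.
Unset Strict Implicit.
Unset Printing Implicit Defensive.

Import Order.TTheory GRing.Theory Num.Theory.
Local Open Scope ring_scope.

(** * Linear maps, submodules and quotients *)

Definition surjective (A B : Type) (f : A -> B) := forall y, exists x, f x = y.

Section Linear.
Context (R : comPzRingType).
Implicit Types A B M N : lmodType R.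

(** Linear maps are bundled through an opaque witness: simplification never
    unfolds them, and their values are reached by [mklinE]. *)
Fact mklin_sig A B (f : A -> B) (lf : linear f) :
  {g : {linear A -> B} | forall x, g x = f x}.
Proof.
by exists (HB.pack_for {linear A -> B} f
  (GRing.isLinear.Build R A B *:%R f lf)).
Qed.
Definition mklin A B (f : A -> B) (lf : linear f) : {linear A -> B} :=
  sval (mklin_sig lf).
Lemma mklinE A B (f : A -> B) (lf : linear f) x : mklin lf x = f x.
Proof. exact: (svalP (mklin_sig lf)). Qed.

Definition submod_pred M (P : M -> Prop) : Prop :=
  P 0 /\ forall a x y, P x -> P y -> P (a *: x + y).

Definition asbool_pred M (P : M -> Prop) (_ : submod_pred P) : M -> bool :=
  fun x => `[< P x >].

Lemma asbool_pred_closed M (P : M -> Prop) (sP : submod_pred P) :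
  subsemimod_closed (asbool_pred sP).
Proof.
case: (sP) => P0 PL; split; first split.
- exact/asboolP.
- by move=> x y /asboolP Px /asboolP Py; apply/asboolP; rewrite -(scale1r x);
  apply: PL.
- by move=> a x /asboolP Px; apply/asboolP; rewrite -[_ *: _]addr0; apply: PL.
Qed.

HB.instance Definition _ M P sP :=
  GRing.isSubmodClosed.Build R M _ (@asbool_pred_closed M P sP).

Definition mksub M (P : M -> Prop) (sP : submod_pred P) : submodClosed M :=
  GRing.SubmodClosed.clone R M (asbool_pred sP) _.

Lemma mksubE M (P : M -> Prop) (sP : submod_pred P) x : x \in mksub sP <-> P x.
Proof. by split=> /asboolP. Qed.

Lemma ker_submod_pred A B (f : {linear A -> B}) : submod_pred
  (fun x => f x = 0).
Proof.
by split=> [|a x y fx fy]; rewrite ?linear0 // linearP fx fy scaler0 addr0.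
Qed.

Lemma im_submod_pred A B (f : {linear A -> B}) :
  submod_pred (fun y => exists x, f x = y).
Proof.
split=> [|a _ _ [x <-] [y <-]]; first by exists 0; rewrite linear0.
by exists (a *: x + y); rewrite linearP.
Qed.

Definition kersub A B (f : {linear A -> B}) := mksub (ker_submod_pred f).
Definition imsub A B (f : {linear A -> B}) := mksub (im_submod_pred f).

Lemma submod_incl_inj M (S : submodClosed M) : injective (@submod_incl R M S).
Proof. exact: val_inj. Qed.

Lemma quotmod_proj_eq0 M (S : submodClosed M) x :
  quotmod_proj S x = 0 <-> x \in S.
Proof.
rewrite -(linear0 (quotmod_proj S)) /quotmod_proj.
by split=> [/quotmodP|xS]; [|apply/quotmodP]; rewrite subr0.
Qed.

Lemma quotmod_proj_surj M (S : submodClosed M) : surjective (quotmod_proj S).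
Proof. by move=> u; exists (repr u); exact: reprK. Qed.

Section Corestrict.
Context A M (S : submodClosed M) (f : {linear A -> M})
  (fS : forall x, f x \in S).

Definition corestrict_fun (x : A) : submod S := Submod (fS x).
Lemma corestrict_linear : linear corestrict_fun.
Proof. by move=> a x y; apply: val_inj; rewrite /= linearP. Qed.
Definition corestrict : {linear A -> submod S} := mklin corestrict_linear.
Lemma corestrictE x : submod_incl (corestrict x) = f x.
Proof. by rewrite mklinE. Qed.
End Corestrict.

Section QuotLift.
Context M B (S : submodClosed M) (f : {linear M -> B}).
Hypothesis fS : forall x, x \in S -> f x = 0.

Let f_repr x : f (repr (quotmod_proj S x)) = f x.
Proof.
apply/eqP; rewrite -subr_eq0 -linearB; apply/eqP/fS/quotmodP.
exact: reprK.
Qed.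

Lemma quot_lift_linear : linear (fun u : quotmod S => f (repr u)).
Proof.
move=> a u v; rewrite -linearP -[RHS]f_repr; congr (f (repr _)).
have rp w : quotmod_proj S (repr w) = w by exact: reprK.
by rewrite linearP /= !rp.
Qed.
Definition quot_lift : {linear quotmod S -> B} := mklin quot_lift_linear.
Lemma quot_liftE x : quot_lift (quotmod_proj S x) = f x.
Proof. by rewrite mklinE f_repr. Qed.
End QuotLift.

Section Inverse.
Context A B (f : {linear A -> B}) (bf : bijective f).
Definition inv_fun (y : B) : A := sval (cid (let: Bijective g _ fK := bf in
   ex_intro (fun x => f x = y) (g y) (fK y))).
Lemma inv_funK y : f (inv_fun y) = y.
Proof. by rewrite /inv_fun; case: cid. Qed.
Lemma inv_linear : linear inv_fun.
Proof. by move=> a x y; apply: (bij_inj bf); rewrite linearP !inv_funK. Qed.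
Definition invlin : {linear B -> A} := mklin inv_linear.
Lemma invlinK : cancel invlin f.
Proof. by move=> y; rewrite mklinE inv_funK. Qed.
Lemma invlinKr : cancel f invlin.
Proof. by move=> x; apply: (bij_inj bf); rewrite invlinK. Qed.
End Inverse.

Lemma linear_injP A B (f : {linear A -> B}) :
  (forall x, f x = 0 -> x = 0) -> injective f.
Proof.
move=> f0 x y fxy; apply/eqP; rewrite -subr_eq0; apply/eqP/f0.
by rewrite linearB fxy subrr.
Qed.

Lemma linear_inj0 A B (f : {linear A -> B}) x : injective f -> f x = 0 -> x = 0.
Proof. by move=> fI fx; apply: fI; rewrite linear0. Qed.

Lemma inj_surj_bij A B (f : {linear A -> B}) :
  injective f -> surjective f -> bijective f.
Proof.
move=> fI fS; exists (fun y => sval (cid (fS y))) => [x|y]; last by case: cid.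
by apply: fI; case: cid.
Qed.

Definition trivial_mod M := forall x : M, x = 0.

End Linear.

(** * The tensor product as a right exact bifunctor *)

Section TensorFunctor.
Context (R : comPzRingType).
Implicit Types A B M N P Q : lmodType R.

Lemma tensDl M N (x x' : M) (y : N) : tens (x + x') y = tens x y + tens x' y.
Proof. by have := (tens_bilinear M N).2 y 1 x x'; rewrite !scale1r. Qed.
Lemma tensDr M N (x : M) (y y' : N) : tens x (y + y') = tens x y + tens x y'.
Proof. by have := (tens_bilinear M N).1 x 1 y y'; rewrite !scale1r. Qed.
Lemma tens0l M N (y : N) : tens (0 : M) y = 0.
Proof. by apply: (addIr (tens 0 y)); rewrite -tensDl !add0r. Qed.
Lemma tens0r M N (x : M) : tens x (0 : N) = 0.
Proof. by apply: (addIr (tens x 0)); rewrite -tensDr !add0r. Qed.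
Lemma tensZl M N a (x : M) (y : N) : tens (a *: x) y = a *: tens x y.
Proof. by have := (tens_bilinear M N).2 y a x 0; rewrite tens0l !addr0. Qed.
Lemma tensZr M N a (x : M) (y : N) : tens x (a *: y) = a *: tens x y.
Proof. by have := (tens_bilinear M N).1 x a y 0; rewrite tens0r !addr0. Qed.
Lemma tensPl M N a (x x' : M) (y : N) :
  tens (a *: x + x') y = a *: tens x y + tens x' y.
Proof. by rewrite tensDl tensZl. Qed.
Lemma tensPr M N a (x : M) (y y' : N) :
  tens x (a *: y + y') = a *: tens x y + tens x y'.
Proof. by rewrite tensDr tensZr. Qed.
Lemma tens_suml M N I (s : seq I) (f : I -> M) (y : N) :
  tens (\sum_(i <- s) f i) y = \sum_(i <- s) tens (f i) y.
Proof.
elim: s => [|i s IH]; first by rewrite !big_nil tens0l.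
by rewrite !big_cons tensDl IH.
Qed.
Lemma tens_sumr M N I (s : seq I) (x : M) (f : I -> N) :
  tens x (\sum_(i <- s) f i) = \sum_(i <- s) tens x (f i).
Proof.
elim: s => [|i s IH]; first by rewrite !big_nil tens0r.
by rewrite !big_cons tensDr IH.
Qed.

Lemma tensor_sum M N (u : tensor M N) :
  exists s : seq (M * N), u = \sum_(p <- s) tens p.1 p.2.
Proof. by exists (repr u); rewrite -tensorE reprK. Qed.

Lemma tensor_ext M N P (f g : {linear tensor M N -> P}) :
  (forall x y, f (tens x y) = g (tens x y)) -> f =1 g.
Proof.
move=> fg u; have [s ->] := tensor_sum u.
by rewrite !linear_sum; apply: eq_bigr => p _; apply: fg.
Qed.

Definition tlift M N P (b : M -> N -> P) (bb : is_bilinear b) :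
  {linear tensor M N -> P} := mklin (tens_lift_linear bb).
Lemma tliftE M N P (b : M -> N -> P) (bb : is_bilinear b) x y :
  tlift bb (tens x y) = b x y.
Proof. by rewrite mklinE tens_liftE. Qed.

Section Map.
Context A B M N (f : {linear A -> B}) (g : {linear M -> N}).
Lemma tmap_bilinear : is_bilinear (fun x y => tens (f x) (g y)).
Proof. by split=> [x|y] a u v; rewrite linearP ?tensPl ?tensPr. Qed.
Definition tmap : {linear tensor A M -> tensor B N} := tlift tmap_bilinear.
Lemma tmapE x y : tmap (tens x y) = tens (f x) (g y).
Proof. exact: tliftE. Qed.
End Map.

Definition idlin M : {linear M -> M} := idfun.

Lemma tens_mapE N A B (f : {linear A -> B}) : tens_map N f =1 tmap (idlin N) f.
Proof.
apply: tensor_ext => x y; rewrite tmapE.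
exact: (tens_liftE (tens_map_bilinear N f)).
Qed.

Lemma tens_map_injE N A B (f : {linear A -> B}) :
  injective (tens_map N f) <-> injective (tmap (idlin N) f).
Proof.
split=> fI x y; first by rewrite -!tens_mapE => /fI.
by rewrite !tens_mapE => /fI.
Qed.

Lemma tmap_comp A B P M N Q (f : {linear A -> B}) (f' : {linear B -> P})
    (h : {linear A -> P}) (g : {linear M -> N}) (g' : {linear N -> Q})
    (k : {linear M -> Q}) :
  (forall x, f' (f x) = h x) -> (forall y, g' (g y) = k y) ->
  forall u, tmap f' g' (tmap f g u) = tmap h k u.
Proof.
move=> fh gk u.
apply: (@tensor_ext _ _ _ (tmap f' g' \o tmap f g)%FUN (tmap h k)) => x y /=.
by rewrite !tmapE fh gk.
Qed.

Lemma tmap_square A B A' B' (f : {linear A -> B}) (g : {linear A' -> B'}) u :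
  tmap f (idlin B') (tmap (idlin A) g u) = tmap (idlin B) g
    (tmap f (idlin A') u).
Proof.
by rewrite (@tmap_comp _ _ _ _ _ _ _ _ f _ _ g) //
  (@tmap_comp _ _ _ _ _ _ _ _ f _ _ g).
Qed.

Lemma tmap_id A M (f : {linear A -> A}) (g : {linear M -> M}) :
  f =1 id -> g =1 id -> tmap f g =1 id.
Proof.
by move=> f1 g1; apply: (@tensor_ext _ _ _ _ (idlin _)) => x y;
  rewrite tmapE f1 g1.
Qed.

Lemma tmap0 A B M N (f : {linear A -> B}) (g : {linear M -> N}) u :
  ((forall x, f x = 0) \/ (forall y, g y = 0)) -> tmap f g u = 0.
Proof.
move=> fg0; have [s ->] := tensor_sum u; rewrite linear_sum big1 // => p _.
by rewrite tmapE; case: fg0 => ->; rewrite ?tens0l ?tens0r.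
Qed.

Lemma tswap_bilinear M N : is_bilinear (fun (x : M) (y : N) => tens y x).
Proof. by split=> [x|y] a u v; rewrite ?tensPl ?tensPr. Qed.
Definition tswap M N : {linear tensor M N -> tensor N M} :=
  tlift (tswap_bilinear M N).
Lemma tswapE M N (x : M) (y : N) : tswap M N (tens x y) = tens y x.
Proof. exact: tliftE. Qed.

Lemma tswapK M N : cancel (tswap M N) (tswap N M).
Proof.
apply: (@tensor_ext _ _ _ (tswap N M \o tswap M N)%FUN (idlin _)) => x y /=.
by rewrite !tswapE.
Qed.

Lemma tswap_tmap A B M N (f : {linear A -> B}) (g : {linear M -> N}) u :
  tswap B N (tmap f g u) = tmap g f (tswap A M u).
Proof.
apply: (@tensor_ext _ _ _ (tswap B N \o tmap f g)%FUN
  (tmap g f \o tswap A M)%FUN).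
by move=> x y /=; rewrite tmapE !tswapE tmapE.
Qed.

Lemma tmap_inj_swap A B M N (f : {linear A -> B}) (g : {linear M -> N}) :
  injective (tmap f g) -> injective (tmap g f).
Proof.
move=> fgI; apply: linear_injP => u gfu; apply: (can_inj (@tswapK _ _)).
by apply: fgI; rewrite -tswap_tmap gfu !linear0.
Qed.

Definition exact A B Q (i : {linear A -> B}) (p : {linear B -> Q}) :=
  forall b, p b = 0 <-> exists a, i a = b.

Definition right_exact A B Q (i : {linear A -> B}) (p : {linear B -> Q}) :=
  exact i p /\ surjective p.

Lemma tmap_surj A B M N (f : {linear A -> B}) (g : {linear M -> N}) :
  surjective f -> surjective g -> surjective (tmap f g).
Proof.
move=> fS gS u; have [s {u}->] := tensor_sum u.
elim: s => [|[x y] s [v IH]]; first by exists 0; rewrite big_nil linear0.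
have [[x' <-] [y' <-]] := (fS x, gS y).
by exists (tens x' y' + v); rewrite big_cons linearD tmapE IH.
Qed.

Section RightExact.
Context N A B Q (i : {linear A -> B}) (p : {linear B -> Q})
  (ip : right_exact i p).
Let T := quotmod (imsub (tmap (idlin N) i)).
Let pr : {linear tensor N B -> T} := quotmod_proj _.
Let sec q := sval (cid (ip.2 q)).
Let secK q : p (sec q) = q. Proof. by rewrite /sec; case: cid. Qed.

Let pr_eq x b b' : p b = p b' -> pr (tens x b) = pr (tens x b').
Proof.
move=> pbb'; have : p (b - b') = 0 by rewrite linearB pbb' subrr.
case/ip.1 => a ia.
have -> : b = i a + b' by rewrite ia subrK.
rewrite tensDr linearD -[RHS]add0r; congr (_ + _).
by apply/quotmod_proj_eq0/mksubE; exists (tens x a); rewrite tmapE.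
Qed.

Let bil : is_bilinear (fun (x : N) (q : Q) => pr (tens x (sec q))).
Proof.
split=> [x|q] a u v; last by rewrite tensPl linearP.
by rewrite -linearP -tensPr; apply: pr_eq; rewrite linearP !secK.
Qed.

(** The inverse [N (x) Q -> (N (x) B) / im] of the map induced by [p] is
    defined on symbols by lifting along [p]; hence nothing more than the
    image of [N (x) A] dies in [N (x) Q]. *)
Lemma tensor_right_exact : right_exact (tmap (idlin N) i) (tmap (idlin N) p).
Proof.
split=> [b|]; last by apply: tmap_surj ip.2 => y; exists y.
split=> [pb0|[a <-]]; last first.
  rewrite (@tmap_comp _ _ _ _ _ _ _ _ (idlin N) _ _ (p \o i)%FUN) //.
  by apply: tmap0; right=> y /=; apply/ip.1; exists y.
apply/(mksubE (im_submod_pred (tmap (idlin N) i)))/quotmod_proj_eq0;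
  rewrite -[quotmod_proj _]/(pr : _ -> _).
have <- : tlift bil (tmap (idlin N) p b) = pr b; last by rewrite pb0 linear0.
apply: (@tensor_ext _ _ _ (tlift bil \o tmap (idlin N) p)%FUN pr) => x y /=.
by rewrite tmapE tliftE; apply: pr_eq; rewrite secK.
Qed.
End RightExact.

Lemma tensor_right_exactl N A B Q (i : {linear A -> B}) (p : {linear B -> Q}) :
  right_exact i p -> right_exact (tmap i (idlin N)) (tmap p (idlin N)).
Proof.
move=> ip; have [E _] := tensor_right_exact N ip.
split=> [b|]; last by apply: tmap_surj => [|y]; [exact: ip.2 | exists y].
have -> : tmap p (idlin N) b = tswap _ _ (tmap (idlin N) p (tswap _ _ b)).
  by rewrite tswap_tmap tswapK.
split=> [/(congr1 (tswap _ _))|[a <-]]; last first.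
  have -> : tmap (idlin N) p (tswap _ _ (tmap i (idlin N) a)) = 0;
    last by rewrite linear0.
  by apply/E; exists (tswap _ _ a); rewrite tswap_tmap.
rewrite tswapK linear0 => /E [a ia].
by exists (tswap _ _ a); rewrite -tswap_tmap ia tswapK.
Qed.

End TensorFunctor.

(** * Direct sums and free modules *)

Section DirectProduct.
Context (R : comPzRingType) (I : Type) (H : I -> lmodType R).

Definition dprod : Type := forall i, H i.
HB.instance Definition _ := gen_eqMixin dprod.
HB.instance Definition _ := gen_choiceMixin dprod.

Let add (x y : dprod) : dprod := fun i => x i + y i.
Let opp (x : dprod) : dprod := fun i => - x i.
Let zero : dprod := fun=> 0.
Let scale (a : R) (x : dprod) : dprod := fun i => a *: x i.

Let addA : associative add.
Proof.
by move=> x y z; apply: functional_extensionality_dep => i; apply: addrA.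
Qed.
Let addC : commutative add.
Proof.
by move=> x y; apply: functional_extensionality_dep => i; apply: addrC.
Qed.
Let add0 : left_id zero add.
Proof.
by move=> x; apply: functional_extensionality_dep => i; apply: add0r.
Qed.
Let addN : left_inverse zero opp add.
Proof.
by move=> x; apply: functional_extensionality_dep => i; apply: addNr.
Qed.
HB.instance Definition _ := GRing.isZmodule.Build dprod addA addC add0 addN.

Let scaleA a b u : scale a (scale b u) = scale (a * b) u.
Proof. by apply: functional_extensionality_dep => i; apply: scalerA. Qed.
Let scale1 : left_id 1 scale.
Proof.
by move=> x; apply: functional_extensionality_dep => i; apply: scale1r.
Qed.
Let scaleDr : right_distributive scale +%R.
Proof.
by move=> a x y; apply: functional_extensionality_dep => i; apply: scalerDr.
Qed.
Let scaleDl u : {morph scale^~ u : a b / a + b}.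
Proof.
by move=> a b; apply: functional_extensionality_dep => i; apply: scalerDl.
Qed.
HB.instance Definition _ :=
  GRing.Zmodule_isLmodule.Build R dprod scaleA scale1 scaleDr scaleDl.

Lemma dprodD (x y : dprod) i : (x + y) i = x i + y i. Proof. by []. Qed.
Lemma dprodZ a (x : dprod) i : (a *: x) i = a *: x i. Proof. by []. Qed.
Lemma dprod_sum (J : Type) (s : seq J) (F : J -> dprod) i :
  (\sum_(k <- s) F k) i = \sum_(k <- s) F k i.
Proof.
elim: s => [|k s IH]; first by rewrite !big_nil.
by rewrite !big_cons dprodD IH.
Qed.
Lemma dprod0 i : (0 : dprod) i = 0. Proof. by []. Qed.

End DirectProduct.

Section DirectSum.
Context (R : comPzRingType) (I : choiceType) (H : I -> lmodType R).

Definition fin_supp (x : dprod H) := exists s : seq I, forall i, i \notin s ->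
  x i = 0.

Lemma fin_supp_submod : submod_pred fin_supp.
Proof.
split=> [|a x y [s xs] [t yt]]; first by exists [::].
exists (s ++ t) => i; rewrite mem_cat negb_or => /andP[/xs xi /yt yi].
by rewrite dprodD dprodZ xi yi scaler0 addr0.
Qed.

Definition dsum : lmodType R := submod (mksub fin_supp_submod).

Definition dcoord_fun i (x : dsum) : H i := submod_incl x i.
Lemma dcoord_linear i : linear (dcoord_fun i).
Proof. by move=> a x y; rewrite /dcoord_fun linearP. Qed.
Definition dcoord i : {linear dsum -> H i} := mklin (@dcoord_linear i).
Lemma dcoordE i x : dcoord i x = submod_incl x i.
Proof. by rewrite mklinE. Qed.

Lemma dsumP (x y : dsum) : (forall i, dcoord i x = dcoord i y) -> x = y.
Proof.
by move=> xy; apply: submod_incl_inj; apply: functional_extensionality_dep => i;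
  have := xy i; rewrite !dcoordE.
Qed.

Lemma dsingle_supp i (h : H i) : (dfwith (0 : dprod H) h : dprod H) \in mksub
  fin_supp_submod.
Proof.
apply/mksubE; exists [:: i] => j; rewrite inE eq_sym => ij.
by rewrite dfwith_out.
Qed.
Definition din_fun i (h : H i) : dsum := Submod (dsingle_supp h).

Lemma dcoord_in_fun i (h : H i) : dcoord i (din_fun h) = h.
Proof. by rewrite dcoordE [LHS]dfwith_in. Qed.
Lemma dcoord_in_fun_out i j (h : H i) : i != j -> dcoord j (din_fun h) = 0.
Proof. by move=> ij; rewrite dcoordE [LHS]dfwith_out. Qed.

Lemma din_linear i : linear (@din_fun i).
Proof.
move=> a x y; apply: dsumP => j; rewrite (linearP (dcoord j)).
have [ij|ij] := eqVneq i j; first by subst j; rewrite !dcoord_in_fun.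
by rewrite !dcoord_in_fun_out // scaler0 addr0.
Qed.
Definition din i : {linear H i -> dsum} := mklin (@din_linear i).

Lemma dcoord_in i (h : H i) : dcoord i (din i h) = h.
Proof. by rewrite [din i h]mklinE dcoord_in_fun. Qed.
Lemma dcoord_in_out i j (h : H i) : i != j -> dcoord j (din i h) = 0.
Proof. by move=> ij; rewrite [din i h]mklinE dcoord_in_fun_out. Qed.

Definition supports (s : seq I) (x : dsum) :=
  uniq s /\ forall i, i \notin s -> dcoord i x = 0.

Lemma supports_ex (x : dsum) : exists s, supports s x.
Proof.
have /mksubE [s xs] := valP x.
by exists (undup s); split;
  [apply: undup_uniq | move=> i; rewrite mem_undup dcoordE => /xs].
Qed.

Lemma supports_widen (s t : seq I) x :
  supports s x -> uniq t -> {subset s <= t} -> supports t x.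
Proof.
by case=> us xs ut st; split=> // i it; apply: xs; apply: contra it => /st.
Qed.

Lemma dsum_expand s x : supports s x -> x = \sum_(i <- s) din i (dcoord i x).
Proof.
case=> us xs; apply: dsumP => j; rewrite linear_sum /=.
have [js|js] := boolP (j \in s); last first.
  rewrite [LHS]xs // big_seq big1 // => i si; apply: dcoord_in_out.
  by apply: contraNneq js => <-.
rewrite (bigD1_seq j) //= dcoord_in big1 ?addr0 // => i ij.
exact: dcoord_in_out.
Qed.

Section Lift.
Context (N : lmodType R) (u : forall i, {linear H i -> N}).

Definition dlift_fun (x : dsum) : N :=
  \sum_(i <- sval (cid (supports_ex x))) u i (dcoord i x).

Lemma dlift_funE s x : supports s x ->
  dlift_fun x = \sum_(i <- s) u i (dcoord i x).
Proof.
rewrite /dlift_fun; case: cid => t /= xt xs.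
have key r : supports r x ->
    \sum_(i <- r) u i (dcoord i x) =
    \sum_(i <- [seq i <- r | dcoord i x != 0]) u i (dcoord i x).
  by move=> _; rewrite big_filter [LHS](bigID (fun i => dcoord i x != 0)) /=
    [X in _ + X]big1 ?addr0 // => i /negPn/eqP ->; rewrite linear0.
rewrite (key _ xs) (key _ xt); apply: perm_big; apply: uniq_perm.
- by rewrite filter_uniq // xt.1.
- by rewrite filter_uniq // xs.1.
move=> i; rewrite !mem_filter; case: (dcoord i x =P 0) => //= /eqP xi.
have in_s r : supports r x -> i \in r.
  by case=> _ xr; apply: contraNT xi => /xr ->.
by rewrite !in_s.
Qed.

Lemma dlift_linear : linear dlift_fun.
Proof.
move=> a x y; have [[s xs] [t yt]] := (supports_ex x, supports_ex y).
have xu : supports (undup (s ++ t)) x.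
  apply: supports_widen xs _ _; first exact: undup_uniq.
  by move=> i si; rewrite mem_undup mem_cat si.
have yu : supports (undup (s ++ t)) y.
  apply: supports_widen yt _ _; first exact: undup_uniq.
  by move=> i si; rewrite mem_undup mem_cat si orbT.
rewrite (dlift_funE xu) (dlift_funE yu) (@dlift_funE (undup (s ++ t))).
  rewrite scaler_sumr -big_split; apply: eq_bigr => i _ /=.
  by rewrite -linearP -linearP.
split=> [|i ist]; first exact: undup_uniq.
by rewrite linearP xu.2 // yu.2 // scaler0 addr0.
Qed.
Definition dlift : {linear dsum -> N} := mklin dlift_linear.

Lemma dlift_in i h : dlift (din i h) = u i h.
Proof.
rewrite mklinE (@dlift_funE [:: i]) ?big_seq1 ?dcoord_in //.
by split=> // j; rewrite inE eq_sym => ij; rewrite dcoord_in_out.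
Qed.
End Lift.

(** An element of the tensor product of the sum with [A] meets finitely many
    summands only and is determined by its components in the [H i (x) A]; if it
    dies in the product with [B], then each component vanishes by flatness of
    [H i]. *)
Lemma flat_dsum : (forall i, flat (H i)) -> flat dsum.
Proof.
move=> Hf A B f fI; apply/tens_map_injE; apply: linear_injP => u fu.
have comp0 i : tmap (dcoord i) (idlin A) u = 0.
  have /tens_map_injE/linear_inj0 := Hf i A B f fI; apply.
  by rewrite -tmap_square fu linear0.
have [l {fu}] : exists l : seq I,
    u = \sum_(i <- l) tmap (din i) (idlin A) (tmap (dcoord i) (idlin A) u).
  have {comp0 fu}[s ->] := tensor_sum u.
  pose ls := [seq sval (cid (supports_ex p.1)) | p <- s].
  exists (undup (flatten ls)).
  under [RHS]eq_bigr do rewrite !linear_sum.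
  rewrite exchange_big /= big_seq [RHS]big_seq; apply: eq_bigr => p sp.
  have xs : supports (undup (flatten ls)) p.1.
    apply: supports_widen (svalP (cid (supports_ex p.1)))
      (undup_uniq _) _ => i pi.
    by rewrite mem_undup; apply/flattenP;
      exists (sval (cid (supports_ex p.1))) => //; apply: map_f.
  rewrite {1}(dsum_expand xs) tens_suml; apply: eq_bigr => i _.
  by rewrite !tmapE.
by move=> ->; rewrite big1 // => i _; rewrite comp0 linear0.
Qed.

End DirectSum.

Arguments dcoord {R I H} i.
Arguments din {R I H} i.

Section Free.
Context (R : comPzRingType).

Lemma mulr_bilinear (A : lmodType R) : is_bilinear
  (fun (a : R^o) (x : A) => a *: x).
Proof.
split=> [a|x] b u v; first by rewrite scalerDr !scalerA mulrC.
by rewrite scalerDl -scalerA.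
Qed.

(** The inverse of [R (x) A -> A] sends [x] to [1 (x) x]. *)
Lemma tensor_R (A : lmodType R) (u : tensor (R^o : lmodType R) A) :
  u = tens (1 : R^o) (tlift (mulr_bilinear A) u).
Proof.
have [s ->] := tensor_sum u; rewrite linear_sum tens_sumr;
  apply: eq_bigr => p _.
by rewrite tliftE tensZr -tensZl; congr tens; rewrite /GRing.scale /= mulr1.
Qed.

Lemma flat_R : flat (R^o : lmodType R).
Proof.
move=> A B f fI; apply/tens_map_injE; apply: linear_injP => u fu.
rewrite (tensor_R u); set x := tlift _ u.
have -> : x = 0; last by rewrite tens0r.
apply: fI; rewrite linear0; move: fu; rewrite (tensor_R u) -/x tmapE.
move/(congr1 (tlift (mulr_bilinear B))).
by rewrite tliftE linear0 /= scale1r.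
Qed.

Definition free (T : Type) : lmodType R := @dsum R {classic T} (fun=> R^o).
Definition fbasis (T : Type) (t : T) : free T :=
  @din R {classic T} (fun=> R^o) t (1 : R^o).

Lemma scale_linear (N : lmodType R) (x : N) : linear (fun a : R^o => a *: x).
Proof. by move=> a u v; rewrite scalerDl -scalerA. Qed.

Definition flift T (N : lmodType R) (u : T -> N) : {linear free T -> N} :=
  @dlift R {classic T} (fun=> R^o) N (fun t => mklin (scale_linear (u t))).

Lemma flift_basis T (N : lmodType R) (u : T -> N) t : flift u (fbasis t) = u t.
Proof. by rewrite [LHS]dlift_in mklinE scale1r. Qed.

Lemma flat_free T : flat (free T).
Proof. by apply: flat_dsum => i; apply: flat_R. Qed.

Lemma free_cover (N : lmodType R) :
  exists (F : lmodType R) (f : {linear F -> N}), flat F /\ surjective f.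
Proof.
exists (free N), (flift id); split; first exact: flat_free.
by move=> y; exists (fbasis y); rewrite flift_basis.
Qed.

End Free.

(** * Vanishing of Tor and flat dimension *)

Section Tor.
Context (R : comPzRingType).
Implicit Types A B K F M N P Q X : lmodType R.

Definition short_exact A B Q (i : {linear A -> B}) (p : {linear B -> Q}) :=
  injective i /\ right_exact i p.

Lemma exact_comp A B Q (i : {linear A -> B}) (p : {linear B -> Q}) x :
  exact i p -> p (i x) = 0.
Proof. by move=> e; apply/e; exists x. Qed.

Lemma short_exact_quot A B (i : {linear A -> B}) :
  injective i -> exists Q (p : {linear B -> Q}), short_exact i p.
Proof.
move=> iI; exists (quotmod (imsub i)), (quotmod_proj (imsub i)).
split=> //; split; last exact: quotmod_proj_surj.
by move=> b; rewrite (quotmod_proj_eq0 (imsub i)); apply: mksubE.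
Qed.

Lemma short_exact_ker B Q (p : {linear B -> Q}) :
  surjective p -> short_exact (@submod_incl R B (kersub p)) p.
Proof.
move=> pS; split; first exact: submod_incl_inj.
split=> // b; split=> [pb|[a <-]].
  by have kb : b \in kersub p; [apply/mksubE | exists (Submod kb)].
exact/(mksubE (ker_submod_pred p))/valP.
Qed.

Lemma short_exact_free Q : exists A B (i : {linear A -> B})
  (p : {linear B -> Q}),
  short_exact i p /\ flat B.
Proof.
have [B [p [Bf pS]]] := free_cover Q.
by exists (submod (kersub p)), B, (@submod_incl R B (kersub p)), p; split;
  first exact: short_exact_ker.
Qed.

(** The part of the snake lemma that measures one obstruction by another:
    in the square of the two sequences, a class of [N'' (x) A] that dies in
    [N'' (x) B] comes from an element of [N' (x) B] whose image in
    [N' (x) Q] is killed by [j (x) Q]. *)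
Lemma tensor_chase N' N N'' A B Q (j : {linear N' -> N}) (q : {linear N -> N''})
    (i : {linear A -> B}) (p : {linear B -> Q}) :
  right_exact j q -> right_exact i p ->
  injective (tmap (idlin N) i) -> injective (tmap j (idlin Q)) ->
  injective (tmap (idlin N'') i).
Proof.
move=> jq ip NiI jQI; apply: linear_injP => x ix.
have [y yx] := (tensor_right_exactl A jq).2 x; subst x.
have /(tensor_right_exactl B jq).1 [b jb] : tmap q (idlin B)
  (tmap (idlin N) i y) = 0.
  by rewrite tmap_square.
have pb : tmap (idlin N') p b = 0.
  apply: (linear_inj0 jQI); rewrite tmap_square jb.
  exact: exact_comp (tensor_right_exact N ip).1.
have [a ab] := ((tensor_right_exact N' ip).1 b).1 pb; subst b.
have -> : y = tmap j (idlin A) a by apply: NiI; rewrite -jb tmap_square.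
exact: exact_comp (tensor_right_exactl A jq).1.
Qed.

(** [Tor_1(N, Q) = 0]: the kernel in question is a quotient of [Tor_1(N, Q)],
    and is all of it when [B] is flat. *)
Definition tor1_eq0 N Q :=
  forall A B (i : {linear A -> B}) (p : {linear B -> Q}),
  short_exact i p -> injective (tmap (idlin N) i).

Lemma flat_inj F A B (i : {linear A -> B}) :
  flat F -> injective i -> injective (tmap (idlin F) i).
Proof. by move=> Ff iI; apply/tens_map_injE/Ff. Qed.

Lemma flat_injl F A B (i : {linear A -> B}) :
  flat F -> injective i -> injective (tmap i (idlin F)).
Proof. by move=> Ff iI; apply/tmap_inj_swap/flat_inj. Qed.

Lemma flatP N : flat N <-> forall Q, tor1_eq0 N Q.
Proof.
split=> [Nf Q A B i p [iI _]|Nt A B f fI]; first exact: flat_inj.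
by apply/tens_map_injE; have [Q [p fp]] := short_exact_quot fI; apply: Nt fp.
Qed.

(** A single flat presentation of [N] decides: by [tensor_chase] it bounds the
    kernels coming from all the sequences that end in [Q]. *)
Lemma tor1_eq0_flat_cover K F N Q (k : {linear K -> F}) (f : {linear F -> N}) :
  short_exact k f -> flat F -> injective (tmap k (idlin Q)) -> tor1_eq0 N Q.
Proof.
move=> [_ kf] Ff kQ A B i p [iI ip].
by apply: tensor_chase kf ip _ kQ; apply: flat_inj.
Qed.

(** A free presentation of [Q] is one of the sequences tested by the
    hypothesis, and is at the same time a flat presentation of [Q]. *)
Lemma tor1_eq0_sym N Q : tor1_eq0 N Q -> tor1_eq0 Q N.
Proof.
move=> NQ; have [A [B [i [p [ip Bf]]]]] := short_exact_free Q.
by apply: (tor1_eq0_flat_cover ip Bf); apply/tmap_inj_swap/(NQ _ _ _ _ ip).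
Qed.

Lemma tor1_eq0_flat_coverP K F N Q (k : {linear K -> F}) (f : {linear F -> N}) :
  short_exact k f -> flat F -> tor1_eq0 N Q <-> injective (tmap k (idlin Q)).
Proof.
move=> kf Ff; split=> [/tor1_eq0_sym QN|];
  last exact: tor1_eq0_flat_cover kf Ff.
exact/tmap_inj_swap/QN/kf.
Qed.

(** Both vanishing conditions say that [K (x) Q' -> F (x) P] is injective. *)
Lemma tor1_eq0_shift K F N Q' P Q (k : {linear K -> F}) (f : {linear F -> N})
    (i : {linear Q' -> P}) (p : {linear P -> Q}) :
  short_exact k f -> flat F -> short_exact i p -> flat P -> tor1_eq0 N Q' <->
    tor1_eq0 K Q.
Proof.
move=> kf Ff ip Pf; rewrite (tor1_eq0_flat_coverP _ kf Ff).
have Fi : injective (tmap (idlin F) i) by apply: flat_inj ip.1.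
have kP : injective (tmap k (idlin P)) by apply: flat_injl kf.1.
have sq u : tmap (idlin F) i (tmap k (idlin Q') u) = tmap k (idlin P)
  (tmap (idlin K) i u).
  by rewrite tmap_square.
split=> [kQ|KQ]; last first.
  apply: linear_injP => u ku; apply: (linear_inj0 (KQ _ _ _ _ ip)).
  by apply: (linear_inj0 kP); rewrite -sq ku linear0.
apply/tor1_eq0_sym/(tor1_eq0_flat_coverP _ ip Pf)/tmap_inj_swap.
apply: linear_injP => u iu; apply: (linear_inj0 kQ).
by apply: (linear_inj0 Fi); rewrite sq iu linear0.
Qed.

Fixpoint is_syz n Q : Prop :=
  if n is m.+1 then exists P Q0 (i : {linear Q -> P}) (p : {linear P -> Q0}),
    [/\ short_exact i p, flat P & is_syz m Q0]
  else True.

(** Flat dimension at most [n], phrased through syzygies of the test modules: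
    [Tor_(n+1)(N, Q0) = Tor_1(N, Q)] for [Q] an [n]-th syzygy of [Q0]. *)
Definition flat_dim_le n N := forall Q, is_syz n Q -> tor1_eq0 N Q.

Lemma flat_dim_le0 N : flat_dim_le 0 N <-> flat N.
Proof. by rewrite flatP; split=> H Q => [|_]; apply: H. Qed.

(** The long exact sequence of Tor for [0 -> K -> F -> N -> 0] shifts degrees
    by one, which on test modules is one more syzygy. *)
Lemma flat_dim_leS n K F N (k : {linear K -> F}) (f : {linear F -> N}) :
  short_exact k f -> flat F -> flat_dim_le n.+1 N <-> flat_dim_le n K.
Proof.
move=> kf Ff; split=> [Nn Q Qn|Kn Q [P [Q0 [i [p [ip Pf Qn]]]]]].
  have [Q' [P [i [p [ip Pf]]]]] := short_exact_free Q.
  by apply/(tor1_eq0_shift kf Ff ip Pf)/Nn; exists P, Q, i, p.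
exact/(tor1_eq0_shift kf Ff ip Pf)/Kn.
Qed.

Lemma tor1_eq0_trivial N Q : trivial_mod N -> tor1_eq0 N Q.
Proof.
move=> N0 A B i p _; apply: linear_injP => u _.
rewrite -(@tmap_id _ _ _ (idlin N) (idlin A) _ _ u) //; apply: tmap0.
by left=> x; apply: N0.
Qed.

Lemma flat_trivial N : trivial_mod N -> flat N.
Proof. by move=> N0; apply/flatP => Q; apply: tor1_eq0_trivial. Qed.

Definition tensor_pure N' N (j : {linear N' -> N}) :=
  forall X, injective (tmap (idlin X) j).

(** [N' (x) A] embeds in [N (x) A], so nothing is lost on the way to
    [N (x) B]. *)
Lemma tor1_eq0_pure_sub N' N Q (j : {linear N' -> N}) :
  tensor_pure j -> tor1_eq0 N Q -> tor1_eq0 N' Q.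
Proof.
move=> jp NQ A B i p ip; apply: linear_injP => u iu.
have jA : injective (tmap j (idlin A)) by apply/tmap_inj_swap/jp.
apply: (linear_inj0 jA); apply: (linear_inj0 (NQ _ _ _ _ ip)).
by rewrite -tmap_square iu linear0.
Qed.

(** Purity is the vanishing of the connecting map in the long exact sequence,
    so a vanishing Tor passes to the quotient without a shift of degree. *)
Lemma tor1_eq0_pure_quot N' N N'' Q (j : {linear N' -> N})
  (q : {linear N -> N''}) :
  tensor_pure j -> right_exact j q -> tor1_eq0 N Q -> tor1_eq0 N'' Q.
Proof.
move=> jp jq NQ A B i p ip; apply: tensor_chase jq ip.2 (NQ _ _ _ _ ip) _.
exact/tmap_inj_swap/jp.
Qed.

Lemma flat_pure_quot N' N N'' (j : {linear N' -> N}) (q : {linear N -> N''}) :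
  tensor_pure j -> right_exact j q -> flat N -> flat N''.
Proof.
move=> jp jq /flatP Nf; apply/flatP => Q.
exact: tor1_eq0_pure_quot jp jq (Nf Q).
Qed.

(** An isomorphism is the quotient by the zero submodule, which is pure. *)
Lemma flat_iso A B (f : {linear A -> B}) : bijective f -> flat A -> flat B.
Proof.
move=> bf; apply: (@flat_pure_quot (submod (kersub f)) _ _
  (@submod_incl _ _ _) f).
  move=> X; apply: linear_injP => u _.
  rewrite -(@tmap_id _ _ _ (idlin X) (idlin _) _ _ u) //; apply: tmap0.
  right=> x; apply: submod_incl_inj; apply: (bij_inj bf).
  have /mksubE := valP x; rewrite /= => fx; rewrite [LHS]fx.
  by rewrite (linear0 (@submod_incl _ _ _)) linear0.
by case: (short_exact_ker (p := f)) => // y; case: bf => g _ gK; exists (g y).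
Qed.

End Tor.

(** * Purity as solvability of linear systems *)

Section EquationalPurity.
Context (R : comPzRingType).
Implicit Types A B M N P Q X : lmodType R.

Definition lin_sys m n (N : lmodType R) (A : 'I_m -> 'I_n -> R) (y : 'I_n -> N)
  (i : 'I_m) : N :=
  \sum_(j < n) A i j *: y j.

Lemma linear_lin_sys m n N N' (f : {linear N -> N'})
  (A : 'I_m -> 'I_n -> R) y i :
  f (lin_sys A y i) = lin_sys A (f \o y) i.
Proof. by rewrite linear_sum; apply: eq_bigr => j _; rewrite linearZ. Qed.

Lemma lin_sysB m n N (A : 'I_m -> 'I_n -> R) (y z : 'I_n -> N) i :
  lin_sys A (fun j => y j - z j) i = lin_sys A y i - lin_sys A z i.
Proof. by rewrite -sumrB; apply: eq_bigr => j _; rewrite scalerBr. Qed.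

Lemma lin_sysN m n N (A : 'I_m -> 'I_n -> R) (y : 'I_n -> N) i :
  lin_sys A (fun j => - y j) i = - lin_sys A y i.
Proof. by rewrite -sumrN; apply: eq_bigr => j _; rewrite scalerN. Qed.

(** Purity of the image of [j]; the system with one equation and no unknown
    contains the injectivity of [j]. *)
Definition eq_pure N' N (j : {linear N' -> N}) :=
  forall m n (A : 'I_m -> 'I_n -> R) (b : 'I_m -> N') (y : 'I_n -> N),
  (forall i, lin_sys A y i = j (b i)) -> exists z, forall i,
    lin_sys A z i = b i.

(** Elements of a free module involve finitely many basis vectors, so to lift
    them along [j] is to solve a finite system of linear equations. *)
Lemma eq_pure_lift N' N (j : {linear N' -> N}) m (w : 'I_m -> free R N)
  (b : 'I_m -> N') :
  eq_pure j -> (forall i, flift id (w i) = j (b i)) ->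
  exists t : {linear free R N -> N'}, forall i, t (w i) = b i.
Proof.
move=> jp wb.
have [s sw] : exists s : seq {classic N}, forall i, supports s (w i).
  pose l i := sval (cid (supports_ex (w i))).
  exists (undup (flatten [seq l i | i <- enum 'I_m])) => i.
  apply: supports_widen (svalP (cid (supports_ex (w i))))
    (undup_uniq _) _ => x xi.
  rewrite mem_undup; apply/flattenP; exists (l i) => //.
  by apply: map_f; rewrite mem_enum.
pose A (i : 'I_m) (k : 'I_(size s)) : R :=
  @dcoord R {classic N} (fun=> R^o) (nth (0 : N) s k) (w i).
have liftE (M : lmodType R) (u : N -> M) i :
    flift u (w i) = lin_sys A (fun k => u (nth (0 : N) s k)) i.
  rewrite [w i](dsum_expand (sw i)) linear_sum (big_nth (0 : N)) big_mkord.
  apply: eq_bigr => k _.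
  by rewrite [LHS]dlift_in mklinE.
have [i|z zb] := jp _ _ A b (fun k => nth (0 : N) s k);
  first by rewrite -wb liftE.
pose u (x : N) := oapp z 0
  (insub (index (x : {classic N}) s) : option 'I_(size s)).
exists (flift u) => i; rewrite liftE -zb; apply: eq_bigr => k _.
by rewrite /u index_uniq ?(sw i).1 // valK.
Qed.

(** A relation [sum x_i (x) j b_i = 0] becomes in [X (x) free N] a
    combination of symbols whose right factors lie over zero. Lifting all the
    free vectors that occur to [N'] carries this combination to the vanishing
    of [sum x_i (x) b_i]. *)
Lemma eq_tensor_pure N' N (j : {linear N' -> N}) : eq_pure j -> tensor_pure j.
Proof.
move=> jp X; apply: linear_injP => u; have [s ->] := tensor_sum u => ju.
pose p : {linear free R N -> N} := flift id.
have pS : surjective p by move=> y; exists (fbasis R y); rewrite flift_basis.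
have kp := short_exact_ker pS; set k : {linear _ -> _} :=
  @submod_incl _ _ (kersub p) in kp.
pose lft x := sval (cid (pS x)); have lftK x : p (lft x) = x by rewrite /lft;
  case: cid.
pose v := \sum_(q <- s) tens q.1 (lft (j q.2)).
have /(tensor_right_exact X kp.2).1 [t kt] : tmap (idlin X) p v = 0.
  rewrite -ju /v !linear_sum; apply: eq_bigr => q _.
  by rewrite !tmapE lftK.
have [r tr] := tensor_sum t; subst t.
(* The free vectors to lift: those chosen over the given symbols, which must
   go back to [b_i], and those lying over zero, which must go to zero. *)
pose w (i : 'I_(size s + size r)) : free R N :=
  match split i with
  | inl a => lft (j (tnth (in_tuple s) a).2)
  | inr c => k (tnth (in_tuple r) c).2 end.
pose b (i : 'I_(size s + size r)) : N' :=
  match split i with inl a => (tnth (in_tuple s) a).2 | inr c => 0 end.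
have [i|f fw] := eq_pure_lift (w := w) (b := b) jp.
  rewrite /w /b; case: split => a; first exact: lftK.
  by rewrite linear0; apply: exact_comp kp.2.1.
have fs (q : X * N') : q \in s -> f (lft (j q.2)) = q.2.
  case/(@tnthP _ _ (in_tuple s)) => a ->.
  by have := fw (lshift _ a); rewrite /w /b (unsplitK (inl a)).
have fr (q : X * submod (kersub p)) : q \in r -> f (k q.2) = 0.
  case/(@tnthP _ _ (in_tuple r)) => a ->.
  by have := fw (rshift _ a); rewrite /w /b (unsplitK (inr a)).
have : tmap (idlin X) f v = 0.
  rewrite -kt !linear_sum big_seq big1 // => q qr.
  by rewrite !tmapE fr // tens0r.
rewrite /v linear_sum => fv; rewrite -[RHS]fv; apply: eq_big_seq => q qs.
by rewrite tmapE fs.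
Qed.

(** Over the module [Y] presented by the transpose of [A], a system with
    right-hand side [b] is solvable exactly when the sum of the [e_i (x) b_i]
    vanishes, where [e_i] are the generators of [Y]. *)
Lemma tensor_eq_pure N' N (j : {linear N' -> N}) : tensor_pure j -> eq_pure j.
Proof.
move=> jp m n A b y Ayb.
pose V k : lmodType R := @dprod R 'I_k (fun=> R^o).
pose e k (i : 'I_k) : V k := fun l => (l == i)%:R.
have co_bil k i : is_bilinear (fun (r : V k) (x : N') => r i *: x).
  split=> [r|x] a u v; first by rewrite scalerDr !scalerA mulrC.
  by rewrite dprodD dprodZ scalerDl -scalerA.
pose co k i := tlift (co_bil k i).
have tr_lin : linear (fun r : V n => (fun i => \sum_(l < n) A i l * r l) : V m).
  move=> a r r'; apply: functional_extensionality_dep => i.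
  rewrite dprodD dprodZ /GRing.scale /= mulr_sumr -big_split;
    apply: eq_bigr => l _ /=.
  by rewrite mulrDr mulrCA.
pose tr := mklin tr_lin.
have [Y [q [iq qS]]] : exists X (q : {linear V m -> X}), right_exact tr q.
  exists (quotmod (imsub tr)), (quotmod_proj _); split;
    last exact: quotmod_proj_surj.
  by move=> r; rewrite (quotmod_proj_eq0 (imsub tr)); apply: mksubE.
have coE i (t : tensor (V n) N') :
    co m i (tmap tr (idlin N') t) = \sum_(l < n) A i l *: co n l t.
  have [s ->] := tensor_sum t; rewrite !linear_sum.
  under [RHS]eq_bigr do rewrite linear_sum scaler_sumr.
  rewrite exchange_big; apply: eq_bigr => p _.
  rewrite tmapE tliftE mklinE scaler_suml; apply: eq_bigr => l _.
  by rewrite tliftE scalerA.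
have colE l : q (\sum_(i < m) A i l *: e m i) = 0.
  apply/iq; exists (e n l); rewrite mklinE;
    apply: functional_extensionality_dep => i.
  rewrite dprod_sum (bigD1 l) // [RHS](bigD1 i) //= /e !eqxx.
  rewrite big1 => [|l' /negbTE ll']; last by rewrite ll' mulr0.
  rewrite big1 => [|k]; last by rewrite eq_sym dprodZ => /negbTE ->;
    rewrite scaler0.
  by rewrite dprodZ eqxx /GRing.scale /= mulr1.
pose t := \sum_(i < m) tens (e m i) (b i).
have [w wt] : exists w, tmap tr (idlin N') w = t.
  apply/(tensor_right_exactl N' (conj iq qS)).1/(linear_inj0 (jp _)).
  rewrite !linear_sum.
  under eq_bigr do rewrite !tmapE -Ayb tens_sumr.
  rewrite exchange_big big1 // => l _ /=.
  under eq_bigr do rewrite tensZr -tensZl -linearZ.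
  by rewrite -tens_suml -linear_sum colE tens0l.
exists (fun l => co n l w) => i; rewrite /lin_sys -coE wt linear_sum
  (bigD1 i) //=.
rewrite tliftE /e eqxx scale1r big1 ?addr0 // => i' ii'.
by rewrite tliftE eq_sym (negbTE ii') scale0r.
Qed.
End EquationalPurity.

(** * Maximal pure submodules *)

Section PureSubsets.
Context (R : comPzRingType).
Implicit Types G H N : lmodType R.

Definition eq_pure_in G (S : G -> Prop) :=
  forall m n (A : 'I_m -> 'I_n -> R) (y : 'I_n -> G),
  (forall i, S (lin_sys A y i)) ->
  exists z, (forall j, S (z j)) /\ forall i, lin_sys A z i = lin_sys A y i.

Definition pure_submod G (S : G -> Prop) := submod_pred S /\ eq_pure_in S.

Lemma pure_submod_eq_pure G (S : submodClosed G) :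
  eq_pure_in (fun x => x \in S) -> eq_pure (@submod_incl R G S).
Proof.
move=> Sp m n A b y yb.
have [i|z [zS zy]] := Sp m n A y; first by rewrite yb; exact: valP.
exists (fun k => Submod (zS k)) => i; apply: submod_incl_inj.
by rewrite linear_lin_sys -yb -zy.
Qed.

(** Solve in the quotient, lift the solution, and correct the error, which
    lies in [S0], by purity of [S0]. *)
Lemma pure_submod_preim G (S0 : submodClosed G) (S : quotmod S0 -> Prop) :
  eq_pure_in (fun x => x \in S0) -> pure_submod S ->
  pure_submod (fun x => S (quotmod_proj S0 x)).
Proof.
move=> S0p [[S00 SL] Sp]; split.
  by split=> [|a x y Sx Sy]; rewrite ?linear0 // linearP; apply: SL.
move=> m n A y yS; have [i|z [zS zy]] := Sp m n A (quotmod_proj S0 \o y).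
  by rewrite -linear_lin_sys; apply: yS.
pose z' k := sval (cid (quotmod_proj_surj (z k))).
have z'K k : quotmod_proj S0 (z' k) = z k by rewrite /z'; case: cid.
have [i|d [dS dE]] := S0p m n A (fun k => y k - z' k).
  apply/quotmod_proj_eq0;
    rewrite lin_sysB linearB !(linear_lin_sys (quotmod_proj S0)) -zy.
    by apply/eqP; rewrite subr_eq0; apply/eqP/eq_bigr => k _; rewrite /= z'K.
exists (fun k => y k - (y k - z' k - d k)); split=> [k|i]; last first.
  by rewrite lin_sysB (lin_sysB _ _ d) dE subrr subr0.
have -> : y k - (y k - z' k - d k) =
  d k + z' k by rewrite opprB addrC -addrA opprB subrK.
by rewrite linearD /= z'K ((quotmod_proj_eq0 S0 _).2 (dS k)) add0r.
Qed.

Local Open Scope classical_set_scope.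

(** Zorn's lemma applies as a finite system involves finitely many elements, so
    that purity passes to unions of chains. *)
Lemma maximal_pure_submod G (L : G -> Prop) : L 0 ->
  exists S : G -> Prop, [/\ pure_submod S, forall x, S x -> L x &
    forall S', pure_submod S' -> (forall x, S' x -> L x) ->
      (forall x, S x -> S' x) -> forall x, S' x -> S x].
Proof.
move=> L0.
(* Adjoining zero turns the union of the empty chain into a submodule. *)
pose z (A : set G) : set G := A `|` [set 0].
pose P (A : set G) := pure_submod (z A) /\ (forall x, z A x -> L x).
have [F FP Ftot|S [[Sp SL] Smax]] := @Zorn_bigcup G P; last first.
  exists (z S); split=> // S' S'p S'L SS' x S'x.
  apply: contrapT => nSx; apply: (Smax S').
    split=> [y Sy|/(_ x S'x) Sx]; first by apply: SS'; left.
    by apply: nSx; left.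
  have zS' : z S' = S'.
    by apply/seteqP; split=> [y [//|->]|y]; [exact: S'p.1.1 | left].
  by rewrite /P zS'.
have [->|/eqP F0] := eqVneq F set0.
  rewrite bigcup_set0.
  split=> [|x [//|-> //]]; split.
    by split=> [|a x y [//|->] [//|->]];
      [right | right; rewrite /= scaler0 addr0].
  move=> m n A y yS; exists (fun=> 0); split=> [j|i]; first by right.
  by case: (yS i) => [//|->]; apply: big1 => j _; rewrite scaler0.
set U := \bigcup_(X in F) X.
have [X0 FX0] : exists X, F X by apply: contrapT => nF; apply: F0; apply/seteqP;
  split=> // X FX; apply: nF; exists X.
have zU x : z U x -> exists2 X, F X & z X x.
  by case=> [[X FX Xx]|->]; [exists X => //; left | exists X0 => //; right].
have zX X x : F X -> z X x -> z U x.
  by move=> FX [Xx|->]; [left; exists X | right].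
have mono (X Y : set G) : X `<=` Y -> z X `<=` z Y by move=> XY x [/XY|];
  [left|right].
have zUs k (y : 'I_k -> G) : (forall i, z U (y i)) -> exists2 X, F X & forall i,
  z X (y i).
  elim: k y => [|k IH] y yU; first by exists X0 => // -[].
  have [X FX Xy] := IH (fun i => y (lift ord0 i)) (fun i => yU _).
  have [Y FY Yy] := zU _ (yU ord0).
  have [XY|YX] := Ftot X Y FX FY.
    by exists Y => // i; case: (unliftP ord0 i) => [j|] ->;
      [exact: mono (Xy j)|].
  by exists X => // i; case: (unliftP ord0 i) => [j|] ->; [|exact: mono Yy].
split=> [|x /zU [X FX]]; last exact: (FP X FX).2.
split.
  split=> [|a x y Ux Uy]; first by right.
  have [i|X FX Xxy] := zUs 2 (fun i => if i == ord0 then x else y);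
    first by case: ifP.
  by apply: (zX X _ FX); apply: (FP X FX).1.1.2;
    [exact: (Xxy ord0) | exact: (Xxy ord_max)].
move=> m n A y /zUs [X FX /((FP X FX).1.2)[t [tX tE]]].
by exists t; split=> // j; apply: (zX X _ FX).
Qed.

End PureSubsets.

(** * Flat precovers *)

Section Terms.
Context (R : comPzRingType).

(** Names for the elements of the smallest submodule that contains a given
    element and is closed under a chosen way of solving linear systems with
    constants in it; [Sol A b j] is the [j]-th component of the solution of the
    system [A y = b]. *)
Inductive term : Type :=
| Var
| Lin of R & term & term
| Sol m n of ('I_m -> 'I_n -> R) & ('I_m -> term) & 'I_n.

(** Names for elements of a module [H] over [N]. A node asks for a family of
    elements of [H], indexed by the terms and respecting linear combinations,
    with prescribed images in [N] and with prescribed values at certain terms,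
    the latter being named by earlier trees; it names one member of the family.
    The branching over all terms makes the named elements a subset of [H] that
    contains a copy over [N] of every small submodule of [H], relative to any
    small part of itself, and yet the type of names does not depend on [H]. *)
Inductive tree (N : Type) : Type :=
| Leaf
| Node of (term -> N) & (term -> Prop) & (term -> tree N) & term.
Arguments Leaf {N}.

Context (N H : lmodType R) (phi : {linear H -> N}).

Definition compatible (psi : term -> N) (D : term -> Prop)
    (v g : term -> H) : Prop :=
  [/\ forall a s t, g (Lin a s t) = a *: g s + g t,
      forall t, phi (g t) = psi t
    & forall t, D t -> g t = v t].

Definition extension psi D v : term -> H :=
  if pselect (exists g, compatible psi D v g) is left e then sval (cid e)
  else fun=> 0.

Lemma extensionP psi D v g :
  compatible psi D v g -> compatible psi D v (extension psi D v).
Proof.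
move=> gP; rewrite /extension; case: pselect => [e|[]]; last by exists g.
by case: (cid e).
Qed.

Fixpoint eval (t : tree N) : H :=
  if t is Node psi D f s then extension psi D (fun r => eval (f r)) s else 0.

Let M (x : H) := exists t, eval t = x.

(** Systems are solved modulo the values of the trees, so that a submodule
    closed under these solutions contains the values of the trees to which its
    elements are congruent modulo [A H^n]. *)
Definition near_sol m n (A : 'I_m -> 'I_n -> R) (b : 'I_m -> H) : 'I_n -> H :=
  if pselect (exists y, forall i, M (b i - lin_sys A y i)) is left e then sval
    (cid e)
  else fun=> 0.

Lemma near_solP m n (A : 'I_m -> 'I_n -> R) (b : 'I_m -> H) y :
  (forall i, M (b i - lin_sys A y i)) -> forall i,
    M (b i - lin_sys A (near_sol A b) i).
Proof.
move=> yP; rewrite /near_sol; case: pselect => [e|[]]; last by exists y.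
by case: (cid e).
Qed.

Fixpoint interp (h : H) (t : term) : H :=
  match t with
  | Var => h
  | Lin a s t => a *: interp h s + interp h t
  | Sol m n A b j => near_sol A (fun i => interp h (b i)) j
  end.

(** One term that computes the difference in every linear reading, so in a
    family and in its copy alike. *)
Lemma sub_term n (a : 'I_n -> R) (q : 'I_n -> term) (t : term) :
  exists s, forall g : term -> H,
    (forall a s t, g (Lin a s t) = a *: g s + g t) ->
    g s = g t - \sum_(j < n) a j *: g (q j).
Proof.
exists (foldr (fun j s => Lin (- a j) (q j) s) t (enum 'I_n)) => g gL.
rewrite -[\sum_(j < n) _]big_enum /=; elim: (enum 'I_n) => [|j l IH] /=.
  by rewrite big_nil subr0.
by rewrite big_cons gL IH scaleNr opprD addrCA.
Qed.

(** An element [h] that no tree evaluates to has a twin: a copy [g] of the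
    submodule [U] generated by [h] under approximate solutions, inside the
    values of the trees, over the same elements of [N] and equal to [U] where
    [U] meets these values. The differences of twins are the pure submodule:
    a system solvable for [g t - t] over [H] says that [t] is solvable
    modulo values of trees, hence modulo values lying in [U], which
    are their own twins and cancel in the difference. *)
Lemma unreached_pure_submod h : ~ M h ->
  exists S : H -> Prop, [/\ pure_submod S, forall x, S x -> phi x = 0 &
    exists2 x, S x & x <> 0].
Proof.
move=> nMh; pose e := interp h.
(* The copy [g] of the family [e] is the one named by the nodes that prescribe
   the values of [e] wherever trees already reach them; [e] itself shows that
   such a family exists. *)
pose f t := if pselect (M (e t)) is left w then sval (cid w) else Leaf.
have fE t : M (e t) -> eval (f t) = e t.
  by move=> w; rewrite /f; case: pselect => // w'; case: cid.
pose D t := M (e t).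
pose g := extension (phi \o e) D (fun t => eval (f t)).
have [gL gphi gD] : compatible (phi \o e) D (fun t => eval (f t)) g.
  apply: (@extensionP _ _ _ e); split=> // t Mt.
  by rewrite fE.
have gM t : M (g t) by exists (Node (phi \o e) D f t).
have gid t : M (e t) -> g t = e t by move=> Mt; rewrite gD // fE.
have eL a s t : e (Lin a s t) = a *: e s + e t by [].
exists (fun x => exists t, x = g t - e t); split; last first.
- exists (g Var - e Var); first by exists Var.
  by move=> /eqP; rewrite subr_eq0 => /eqP gh; apply: nMh; rewrite -[h]gh.
- by move=> _ [t ->]; rewrite linearB gphi subrr.
split; first split=> [|a _ _ [s ->] [t ->]].
- exists (Lin (-1) Var Var); rewrite gL eL !scaleN1r.
  by rewrite !addNr subrr.
- by exists (Lin a s t); rewrite gL eL scalerBr opprD addrACA.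
move=> m n A y /choice [t tE].
(* Since [e (t i) - A (- y) = g (t i)] is a value of a tree, the chosen
   solutions [q] bring [e (t i)] to values of trees as well. *)
pose q j := Sol A t j.
exists (fun j => g (q j) - e (q j)); split=> [j|i]; first by exists (q j).
have /(_ i) Mi : forall i, M (e (t i) - lin_sys A (e \o q) i).
  apply: (@near_solP _ _ A (e \o t) (fun j => - y j)) => k.
  by rewrite lin_sysN opprK tE /= addrC subrK; apply: gM.
have [s sE] := sub_term (A i) q (t i).
have := gid s; rewrite (sE g gL) (sE e eL) => /(_ Mi) gs.
move/eqP: gs; rewrite subr_eq => /eqP gt.
by rewrite lin_sysB tE gt addrC [RHS]addrC -[in RHS]addrA addKr.
Qed.

End Terms.

Section Precover.
Context (R : comPzRingType).
Implicit Types F G H N : lmodType R.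

(** Dividing by a maximal pure submodule of the kernel leaves a module all of
    whose elements are values of trees, which bounds its size in terms of [R]
    and [N] only. *)
Lemma flat_factor_bounded G N (phi : {linear G -> N}) : flat G ->
  exists H (p : {linear G -> H}) (psi : {linear H -> N}) (e : tree R N -> H),
  [/\ flat H, forall x, psi (p x) = phi x & surjective e].
Proof.
move=> Gf; have [|P [[Ps Pp] Pphi Pmax]] :=
  @maximal_pure_submod R G (fun x => phi x = 0).
  exact: linear0.
pose S := mksub Ps.
have Sp : eq_pure_in (fun x => x \in S).
  move=> m n A y yS; have [i|z [zP zy]] := Pp m n A y.
    exact/(mksubE Ps)/yS.
  by exists z; split=> // j; apply/mksubE.
have phiS x : x \in S -> phi x = 0 by move/(mksubE Ps)/Pphi.
exists (quotmod S), (quotmod_proj S), (quot_lift phiS), (eval (quot_lift phiS)).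
split=> [|x|h]; last first.
- apply: contrapT => /unreached_pure_submod[S' [S'p S'phi [x S'x]]]; apply.
  have [y yx] := quotmod_proj_surj x; subst x.
  apply/quotmod_proj_eq0/mksubE.
  apply: (Pmax (fun x => S' (quotmod_proj S x))) => //
    [|z /S'phi|z /(mksubE Ps) zS].
  - exact: pure_submod_preim.
  - by rewrite quot_liftE.
  by rewrite ((quotmod_proj_eq0 S z).2 zS); exact: S'p.1.1.
- exact: quot_liftE.
apply: (@flat_pure_quot _ _ _ _ (@submod_incl R G S) (quotmod_proj S)) Gf.
  exact/eq_tensor_pure/pure_submod_eq_pure.
split; last exact: quotmod_proj_surj.
move=> b; rewrite quotmod_proj_eq0; split=> [bS|[a <-]]; last exact: valP.
by exists (Submod bS).
Qed.

Theorem flat_precover N : exists F (f : {linear F -> N}), flat F /\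
  forall G (g : {linear G -> N}), flat G ->
    exists h : {linear G -> F}, forall x, f (h x) = g x.
Proof.
(* Up to isomorphism the bounded flat modules over [N] are quotients of one
   free module, so they are indexed by a type of the right size. *)
pose Tr := free R (tree R N).
pose J := {p : (@sigT (submodClosed Tr) (fun K => {linear quotmod K -> N})) |
  flat (quotmod (projT1 p))}.
pose W (p : {classic J}) : lmodType R := quotmod (projT1 (sval p)).
pose w (p : {classic J}) : {linear W p -> N} := projT2 (sval p).
exists (dsum W), (dlift w); split=> [|G g Gf].
  by apply: flat_dsum => p; apply: (svalP p).
have [H [p [psi [e [Hf pg eS]]]]] := flat_factor_bounded g Gf.
pose u : {linear Tr -> H} := flift e.
have u0 x : x \in kersub u -> u x = 0 by move/mksubE.
pose b := quot_lift u0.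
have bb : bijective b.
  apply: inj_surj_bij => [|y].
    apply: linear_injP => v; have [x <-] := quotmod_proj_surj v.
    by rewrite quot_liftE => ux; apply/quotmod_proj_eq0/mksubE.
  have [t <-] := eS y; exists (quotmod_proj _ (fbasis R t)).
  by rewrite quot_liftE /u flift_basis.
have Kf : flat (quotmod (kersub u)).
  apply: (@flat_iso _ _ _ (invlin bb) _ Hf).
  by exists b; [exact: invlinK | exact: invlinKr].
pose c : {linear quotmod (kersub u) -> N} := (psi \o b)%FUN.
pose k : J := exist (fun p => flat (quotmod (projT1 p)))
  (existT _ (kersub u) c) Kf.
exists (@din R {classic J} W k \o (invlin bb \o p))%FUN => x /=.
by rewrite dlift_in /w /= invlinK pg.
Qed.

End Precover.

(** * Finite presentation over a noetherian ring *)

Section FinitePresentation.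
Context (R : comPzRingType).
Implicit Types C M N : lmodType R.

(** Finite generation without coefficients: [P] is the least submodule that
    contains [s]. *)
Definition fin_gen M (P : M -> Prop) := exists s : seq M,
  (forall x, x \in s -> P x) /\
  forall Q : M -> Prop, submod_pred Q -> (forall x, x \in s -> Q x) ->
  forall x, P x -> Q x.

Lemma submod_pred_sum M (P : M -> Prop) I (s : seq I) (a : I -> R)
  (x : I -> M) :
  submod_pred P -> (forall i, P (x i)) -> P (\sum_(i <- s) a i *: x i).
Proof.
move=> [P0 PL] Px; elim: s => [|i s IH]; first by rewrite big_nil.
by rewrite big_cons; apply: PL.
Qed.

Lemma noetherian_fin_gen_ideal (P : (R^o : lmodType R) -> Prop) :
  noetherian R -> submod_pred P -> fin_gen P.
Proof.
move=> nR Ps; have [s sE] := nR (mksub Ps).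
exists [seq val x | x <- s]; split=> [_ /mapP[x _ ->]|Q Qs sQ x Px].
  exact/(mksubE Ps)/valP.
have xI : x \in mksub Ps by apply/mksubE.
have [c /(congr1 (@submod_incl R _ (mksub Ps)))] := sE (Submod xI).
rewrite linear_sum => xE; rewrite [x]xE; under eq_bigr do rewrite linearZ.
by apply: submod_pred_sum => // i; apply/sQ/map_f/mem_nth.
Qed.

Definition vec n : lmodType R := @dprod R 'I_n (fun=> R^o).

Definition vec_cons n (x : R) (y : vec n) : vec n.+1 :=
  fun i => oapp y x (unlift ord0 i).

Lemma vec_consL n a (x x' : R) (y y' : vec n) :
  vec_cons (a * x + x') (a *: y + y') = a *: vec_cons x y + vec_cons x' y'.
Proof.
apply: functional_extensionality_dep => i; rewrite dprodD dprodZ /vec_cons.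
by case: unlift.
Qed.

(** Hilbert's argument: the first coordinates form an ideal, and the vectors
    with vanishing first coordinate live in a shorter free module. *)
Lemma noetherian_fin_gen n (P : vec n -> Prop) : noetherian R ->
  submod_pred P -> fin_gen P.
Proof.
move=> nR; elim: n P => [|n IH] P Ps.
  exists [::]; split=> // Q [Q0 _] _ x _.
  by have -> : x = 0 by apply: functional_extensionality_dep => -[].
have [|s [sP sQ]] := @noetherian_fin_gen_ideal
  (fun r => exists2 x, P x & x ord0 = r) nR.
  split=> [|a _ _ [x Px <-] [y Py <-]]; first by exists 0; case: Ps.
  by exists (a *: x + y) => //; apply: Ps.2.
have cons0L a (y y' : vec n) :
    vec_cons 0 (a *: y + y') = a *: vec_cons 0 y + vec_cons 0 y'.
  by rewrite -vec_consL mulr0 addr0.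
have cons00 : vec_cons 0 (0 : vec n) = 0.
  by apply: functional_extensionality_dep => i; rewrite /vec_cons; case: unlift.
have [|t [tP tQ]] := IH (fun y => P (vec_cons 0 y)).
  split=> [|a y y' Py Py']; first by rewrite cons00; case: Ps.
  by rewrite cons0L; apply: Ps.2.
pose l r : vec n.+1 := if pselect (exists2 x, P x & x ord0 = r) is left e
  then s2val (cid2 e) else 0.
have lP r : r \in s -> P (l r) /\ l r ord0 = r.
  by move/sP; rewrite /l => e; case: pselect => // e'; case: cid2.
exists ([seq l r | r <- s] ++ [seq vec_cons 0 y | y <- t]);
  split=> [x|Q Qs stQ x Px].
  by rewrite mem_cat => /orP[] /mapP[y ys ->]; [case: (lP y ys) | apply: tP].
have [z [Pz Qz] zx] : exists2 z, P z /\ Q z & z ord0 = x ord0.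
  apply: (sQ (fun r => exists2 z, P z /\ Q z & z ord0 = r)); last by exists x.
  - split=> [|a _ _ [y [Py Qy] <-] [y' [Py' Qy'] <-]].
      by exists 0 => //; split; [case: Ps | case: Qs].
    by exists (a *: y + y') => //; split; [apply: Ps.2 | apply: Qs.2].
  - move=> r rs; have [Pl lr] := lP r rs; exists (l r) => //; split=> //.
    by apply: stQ; rewrite mem_cat map_f.
pose y : vec n := fun i => (x - z) (lift ord0 i).
have xz : x - z = vec_cons 0 y.
  apply: functional_extensionality_dep => i; rewrite /vec_cons.
  case: (unliftP ord0 i) => [j|] -> //=.
  by rewrite dprodD -scaleN1r dprodZ zx scaleN1r subrr.
have : Q (vec_cons 0 y).
  apply: (tQ (fun y => Q (vec_cons 0 y))).
  - split=> [|a u v Qu Qv]; first by rewrite cons00; case: Qs.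
    by rewrite cons0L; apply: Qs.2.
  - by move=> u ut; apply: stQ; rewrite mem_cat map_f ?orbT.
  by rewrite -xz addrC -scaleN1r; apply: Ps.2.
rewrite -xz => Qxz; rewrite -[x](subrK z) -[x - z]scale1r.
exact: Qs.2.
Qed.

(** The last clause is the universal property of the module with generators
    [c] and relations [rho]. *)
Definition finpres C l k (c : 'I_l -> C) (rho : 'I_k -> 'I_l -> R) := [/\
  forall x, exists a : 'I_l -> R, x = \sum_(i < l) a i *: c i,
  forall s, lin_sys rho c s = 0
  & forall M (m : 'I_l -> M), (forall s, lin_sys rho m s = 0) ->
    exists f : {linear C -> M}, forall i, f (c i) = m i].

Lemma comb_linear l M (m : 'I_l -> M) :
  linear (fun a : vec l => \sum_(i < l) a i *: m i).
Proof.
move=> a u v; rewrite scaler_sumr -big_split; apply: eq_bigr => i _ /=.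
by rewrite dprodD dprodZ scalerDl -scalerA.
Qed.
Definition comb l M (m : 'I_l -> M) : {linear vec l -> M} :=
  mklin (comb_linear m).

(** Finitely many relations generate the kernel of [R^l -> C], and a family
    that satisfies these satisfies all relations, whence the map out of [C] is
    well defined. *)
Lemma noetherian_finpres C : noetherian R -> fingen C ->
  exists l k (c : 'I_l -> C) (rho : 'I_k -> 'I_l -> R), finpres c rho.
Proof.
move=> nR [g gC]; pose c (i : 'I_(size g)) := g`_i.
have [r [rP rQ]] := noetherian_fin_gen nR (ker_submod_pred (comb c)).
pose rho (s : 'I_(size r)) : vec (size g) := tnth (in_tuple r) s.
exists (size g), (size r), c, rho; split=> [||M m mr].
- exact: gC.
- by move=> s; have := rP _ (mem_tnth s (in_tuple r)); rewrite mklinE.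
have key (a b : vec (size g)) : \sum_i a i *: c i = \sum_i b i *: c i ->
    \sum_i a i *: m i = \sum_i b i *: m i.
  move=> ab; have : comb c (a - b) = 0.
    by rewrite linearB !mklinE ab subrr.
  move/(rQ _ (ker_submod_pred (comb m))); rewrite linearB !mklinE => H.
  apply/eqP; rewrite -subr_eq0 H // => x.
  by case/(@tnthP _ _ (in_tuple r)) => s ->; rewrite mklinE; apply: mr.
pose a x : vec (size g) := sval (cid (gC x));
  have aE x : \sum_i a x i *: c i = x.
  by rewrite /a; case: cid => /= b ->.
have f_lin : linear (fun x => \sum_i a x i *: m i).
  move=> e x y; rewrite -!(mklinE (comb_linear m)) -linearP !mklinE.
  by apply: key; rewrite aE -(mklinE (comb_linear c)) linearP !mklinE !aE.
exists (mklin f_lin) => i; rewrite mklinE.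
pose d : vec (size g) := fun i' => (i' == i)%:R.
have dE (M' : lmodType R) (m' : 'I_(size g) -> M') : \sum_i' d i' *: m' i' =
  m' i.
  rewrite (bigD1 i) //= /d eqxx scale1r big1 ?addr0 // => j /negbTE ->.
  exact: scale0r.
by rewrite -[RHS]dE; apply: key; rewrite aE dE.
Qed.

End FinitePresentation.

(** * The module of linear maps *)

Section Hom.
Context (R : comPzRingType).
Implicit Types A B C D M N F G X Y : lmodType R.

Lemma hom_submod C M : submod_pred
  (fun f : @dprod R C (fun=> M) => linear (f : C -> M)).
Proof.
split=> [|a f g fl gl] b x y;
  rewrite ?dprodD ?dprodZ ?dprod0 ?scaler0 ?addr0 //.
by rewrite fl gl !scalerDr !scalerA mulrC addrACA.
Qed.

Definition hom C M : lmodType R := submod (mksub (hom_submod C M)).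

Lemma hom_linear C M (u : hom C M) : linear (submod_incl u : C -> M).
Proof. by have /mksubE := valP u. Qed.
Definition homf C M (u : hom C M) : {linear C -> M} := mklin (hom_linear u).

Lemma homfE C M (u : hom C M) x : homf u x = submod_incl u x.
Proof. by rewrite mklinE. Qed.

Lemma homP C M (u v : hom C M) : (forall x, homf u x = homf v x) -> u = v.
Proof.
move=> uv; apply: submod_incl_inj; apply: functional_extensionality_dep => x.
by rewrite -!homfE.
Qed.

Lemma homfD C M a (u v : hom C M) x : homf
  (a *: u + v) x = a *: homf u x + homf v x.
Proof. by rewrite !homfE linearP. Qed.

Lemma homf0 C M x : homf (0 : hom C M) x = 0.
Proof. by rewrite homfE linear0. Qed.

Lemma mkhom_subproof C M (f : {linear C -> M}) :
  (f : @dprod R C (fun=> M)) \in mksub (hom_submod C M).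
Proof. by apply/mksubE => a x y; apply: linearP. Qed.
Definition mkhom C M (f : {linear C -> M}) : hom C M :=
  Submod (mkhom_subproof f).

Lemma mkhomE C M (f : {linear C -> M}) x : homf (mkhom f) x = f x.
Proof. by rewrite homfE. Qed.

Lemma homf_eval_linear C M x : linear (fun u : hom C M => homf u x).
Proof. by move=> a u v; apply: homfD. Qed.

Section Post.
Context C M N (f : {linear M -> N}).
Lemma hom_post_linear : linear (fun u : hom C M => mkhom (f \o homf u)%FUN).
Proof.
move=> a u v; apply: homP => x; rewrite homfD !mkhomE /= homfD linearP.
by [].
Qed.
Definition hom_post : {linear hom C M -> hom C N} := mklin hom_post_linear.
Lemma hom_postE u x : homf (hom_post u) x = f (homf u x).
Proof. by rewrite [hom_post u]mklinE mkhomE. Qed.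
End Post.

Lemma eq_pure_fin N' N (j : {linear N' -> N}) (I J : finType) (A : I -> J -> R)
    (b : I -> N') (y : J -> N) : eq_pure j ->
  (forall i, \sum_k A i k *: y k = j (b i)) ->
  exists z, forall i, \sum_k A i k *: z k = b i.
Proof.
move=> jp yb.
pose A' (i : 'I_#|I|) (k : 'I_#|J|) := A (enum_val i) (enum_val k).
have [i|z zb] := jp _ _ A' (fun i => b (enum_val i)) (fun k => y (enum_val k)).
  by rewrite -yb (reindex (fun k : 'I_#|J| => enum_val k)) //=; apply: onW_bij;
    apply: enum_val_bij.
exists (z \o enum_rank) => i; rewrite -[i]enum_rankK -[RHS]zb.
rewrite [LHS](reindex (fun k : 'I_#|J| => enum_val k)) /=;
  last by apply: onW_bij; apply: enum_val_bij.
by apply: eq_bigr => k _; rewrite enum_valK.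
Qed.

Lemma eq_pure_inj N' N (j : {linear N' -> N}) : eq_pure j -> injective j.
Proof.
move=> jp; apply: linear_injP => x jx.
have [i|z zx] := jp 1%N 0%N (fun _ _ => 0) (fun=> x) (fun=> 0).
  by rewrite /lin_sys big_ord0 jx.
by have := zx ord0; rewrite /lin_sys big_ord0.
Qed.

Section FinPres.
Context C l k (c : 'I_l -> C) (rho : 'I_k -> 'I_l -> R) (cP : finpres c rho).

Lemma finpres_ext M (f g : {linear C -> M}) :
  (forall i, f (c i) = g (c i)) -> f =1 g.
Proof.
move=> fg x; have [cg _ _] := cP; have [a ->] := cg x.
by rewrite !linear_sum; apply: eq_bigr => i _; rewrite !linearZ /= fg.
Qed.

(** A system over [hom C N] is a larger system over [N]: the unknowns are the
    values on the generators of [C], and the relations of [C] are further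
    equations, with right-hand side zero. *)
Lemma hom_post_eq_pure N' N (j : {linear N' -> N}) : eq_pure j ->
  eq_pure (@hom_post C _ _ j).
Proof.
move=> jp m n A b y yb; have [cg crho cU] := cP.
(* Equations of the first kind evaluate the given system at a generator; those
   of the second kind make the values of each unknown respect a relation. *)
pose B (e : 'I_m * 'I_l + 'I_k * 'I_n) (u : 'I_n * 'I_l) : R :=
  match e with
  | inl (i, a) => if u.2 == a then A i u.1 else 0
  | inr (s, q) => if u.1 == q then rho s u.2 else 0
  end.
have BEl (M : lmodType R) i a (w : 'I_n * 'I_l -> M) :
    \sum_u B (inl (i, a)) u *: w u = \sum_(q < n) A i q *: w (q, a).
  transitivity (\sum_q \sum_a' B (inl (i, a)) (q, a') *: w (q, a')).
    by rewrite pair_bigA; apply: eq_bigr => -[].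
  apply: eq_bigr => q _ /=; rewrite (bigD1 a) //=
    eqxx big1 ?addr0 // => a' /negbTE ->.
  exact: scale0r.
have BEr (M : lmodType R) s q (w : 'I_n * 'I_l -> M) :
    \sum_u B (inr (s, q)) u *: w u = \sum_(a < l) rho s a *: w (q, a).
  transitivity (\sum_q' \sum_a B (inr (s, q)) (q', a) *: w (q', a)).
    by rewrite pair_bigA; apply: eq_bigr => -[].
  rewrite (bigD1 q) //= [X in _ + X]big1 => [|q' /negbTE ->]; last first.
    by rewrite big1 // => a _; apply: scale0r.
  by rewrite addr0; apply: eq_bigr => a _; rewrite eqxx.
have [|z zb] := @eq_pure_fin _ _ j _ _ B
    (fun e => if e is inl (i, a) then homf (b i) (c a) else 0)
    (fun u => homf (y u.1) (c u.2)) jp.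
  case=> [[i a]|[s q]].
    rewrite BEl /= -hom_postE -yb -[RHS](mklinE (@homf_eval_linear C N (c a))).
    by rewrite linear_sum; apply: eq_bigr => q _; rewrite linearZ /= mklinE.
  by rewrite BEr /= linear0 -[LHS](linear_lin_sys (homf (y q)) rho c) crho
    linear0.
have zf q : exists f : {linear C -> N'}, forall a, f (c a) = z (q, a).
  by apply: cU => s; have := zb (inr (s, q)); rewrite BEr.
exists (fun q => mkhom (sval (cid (zf q)))) => i; apply: homP.
apply: finpres_ext => a; rewrite -[RHS](zb (inl (i, a))) BEl.
rewrite -[LHS](mklinE (@homf_eval_linear C N' (c a))) linear_sum.
apply: eq_bigr => q _; rewrite linearZ /= mklinE mkhomE.
by case: cid => f /= ->.
Qed.

(** Lifts of the images of the generators violate the relations by elements of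
    [N'], and purity provides a correction inside [N']. *)
Lemma hom_post_right_exact N' N N'' (j : {linear N' -> N})
  (q : {linear N -> N''}) :
  eq_pure j -> right_exact j q -> right_exact (@hom_post C _ _ j)
    (@hom_post C _ _ q).
Proof.
move=> jp [jq qS]; have jI := eq_pure_inj jp; have [cg crho cU] := cP.
split=> [g|g].
  split=> [qg|[f <-]]; last first.
    by apply: homP => x; rewrite !hom_postE homf0; apply: exact_comp jq.
  have gj x : exists y, j y = homf g x.
    by apply/jq; rewrite -hom_postE qg homf0.
  pose f x := sval (cid (gj x)); have fE x : j (f x) = homf g x by rewrite /f;
    case: cid.
  have fl : linear f by move=> a x y; apply: jI; rewrite linearP !fE linearP.
  by exists (mkhom (mklin fl)); apply: homP => x;
    rewrite hom_postE mkhomE mklinE fE.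
pose m i := sval (cid (qS (homf g (c i)))).
have mE i : q (m i) = homf g (c i) by rewrite /m; case: cid.
have mj s : exists y, j y = lin_sys rho m s.
  apply/jq; rewrite linear_lin_sys; have := congr1 (homf g) (crho s).
  rewrite linear_lin_sys linear0 => <-; apply: eq_bigr => i _; congr (_ *: _);
    exact: mE.
pose b s := sval (cid (mj s)).
have bE s : j (b s) = lin_sys rho m s by rewrite /b; case: cid.
have [s|z zb] := jp _ _ rho b m; first by rewrite bE.
have [|f fE] := cU N (fun i => m i - j (z i)).
  by move=> s; rewrite lin_sysB -(linear_lin_sys j) zb bE subrr.
exists (mkhom f); apply: homP; apply: finpres_ext => i.
by rewrite hom_postE mkhomE fE linearB mE (exact_comp _ jq) subr0.
Qed.

End FinPres.

Section Unit.
Context F C.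
Lemma unit_linear2 (x : F) : linear (fun c : C => tens x c).
Proof. by move=> a u v; apply: tensPr. Qed.
Lemma unit_linear : linear (fun x : F => mkhom (mklin (unit_linear2 x))).
Proof.
by move=> a u v; apply: homP => c; rewrite homfD !mkhomE !mklinE tensPl.
Qed.
Definition tens_unit : {linear F -> hom C (tensor F C)} := mklin unit_linear.
Lemma tens_unitE x c : homf (tens_unit x) c = tens x c.
Proof. by rewrite [tens_unit x]mklinE mkhomE mklinE. Qed.
End Unit.

(** The quotient of [B] by the image of [i] embeds in [D], and the flat module
    [F] keeps it embedded. *)
Lemma flat_exact F A B D (i : {linear A -> B}) (p : {linear B -> D}) : flat F ->
  exact i p -> exact (tmap (idlin F) i) (tmap (idlin F) p).
Proof.
move=> Ff ip.
have p0 x : x \in imsub i -> p x = 0 by move/(mksubE (im_submod_pred i))/ip.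
pose q : {linear B -> quotmod (imsub i)} := quotmod_proj (imsub i).
have iq : right_exact i q.
  split; last exact: quotmod_proj_surj.
  by move=> b; rewrite /q (quotmod_proj_eq0 (imsub i)); apply: mksubE.
pose p' := quot_lift p0.
have p'I : injective p'.
  apply: linear_injP => u; have [x <-] := quotmod_proj_surj u.
  by rewrite quot_liftE => /ip/(mksubE (im_submod_pred i)) xi;
    apply/quotmod_proj_eq0.
move=> b; rewrite -((tensor_right_exact F iq).1 b).
have <- : tmap (idlin F) p' (tmap (idlin F) q b) = tmap (idlin F) p b.
  by apply: tmap_comp => // x; apply: quot_liftE.
split=> [|->]; last exact: linear0.
exact/linear_inj0/flat_inj.
Qed.

(** Evaluation at the generators embeds [hom C X] in [X^l] as the kernel of the
    relations; for [X = C] this kernel is [R] itself, and tensoring the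
    exact sequence [0 -> R -> C^l -> C^k] with [F] gives the case
    [X = F (x) C]. *)
Lemma tens_unit_bij F C l k (c : 'I_l -> C) (rho : 'I_k -> 'I_l -> R) :
  finpres c rho -> (forall f : {linear C -> C}, exists! a : R, f =1 *:%R a) ->
  flat F -> bijective (tens_unit F C).
Proof.
move=> cP hC Ff; have [cg crho cU] := cP.
pose pow n : lmodType R := @dprod R 'I_n (fun=> C).
have in_lin n (i : 'I_n) : linear
  (fun x : C => (fun i' => if i' == i then x else 0) : pow n).
  move=> a x y; apply: functional_extensionality_dep => i';
    rewrite dprodD dprodZ.
  by case: eqP => // _; rewrite scaler0 addr0.
pose inj n i := mklin (in_lin n i).
have pr_lin n (i : 'I_n) : linear (fun v : pow n => v i) by [].
pose pr n i := mklin (pr_lin n i).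
have io_lin : linear (fun r : R^o => (fun i => r *: c i) : pow l).
  move=> a r s; apply: functional_extensionality_dep => i.
  by rewrite dprodD dprodZ scalerDl scalerA.
pose io : {linear (R^o : lmodType R) -> pow l} := mklin io_lin.
have ro_lin : linear (fun v : pow l => (fun s => lin_sys rho v s) : pow k).
  move=> a u v; apply: functional_extensionality_dep => s.
  rewrite dprodD dprodZ /lin_sys scaler_sumr -big_split;
    apply: eq_bigr => i _ /=.
  by rewrite dprodD dprodZ scalerDr !scalerA mulrC.
pose ro := mklin ro_lin.
have scal_lin (a : R) : linear (fun x : C => a *: x).
  by move=> b x y; rewrite scalerDr !scalerA mulrC.
have ioI : injective io.
  apply: linear_injP => r; rewrite mklinE => rc.
  have r0 : mklin (scal_lin r) =1 mklin (scal_lin 0).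
    apply: (finpres_ext cP) => i; rewrite !mklinE scale0r.
    exact: (congr1 (fun f : pow l => f i) rc).
  have [a [_ aU]] := hC (mklin (scal_lin 0)).
  have ar : a = r by apply: aU => x; rewrite -r0 mklinE.
  have a0 : a = 0 by apply: aU => x; rewrite mklinE.
  by rewrite -ar a0.
have ior : exact io ro.
  move=> v; split=> [rv|[r <-]]; last first.
    rewrite !mklinE; apply: functional_extensionality_dep => s.
    rewrite -[RHS](scaler0 C r) -[X in _ = _ *: X](crho s) scaler_sumr.
    by apply: eq_bigr => i _; rewrite !scalerA mulrC.
  have [s|f fc] := cU C v.
    by move: rv; rewrite mklinE => /(congr1 (fun f : pow k => f s)).
  have [r [fr _]] := hC f; exists r; rewrite mklinE.
  by apply: functional_extensionality_dep => i; rewrite -fc fr.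
have ioF := flat_exact Ff ior.
have roinj i x : ro (inj l i x) = \sum_(s < k) rho s i *: inj k s x.
  rewrite !mklinE; apply: functional_extensionality_dep => s.
  rewrite dprod_sum (bigD1 s) //= dprodZ mklinE eqxx [RHS]addrC big1 ?add0r.
    rewrite /lin_sys (bigD1 i) //= eqxx [X in _ + X]big1 ?addr0 // => i'
      /negbTE ->.
    exact: scaler0.
  by move=> s' ss'; rewrite dprodZ mklinE eq_sym (negbTE ss') scaler0.
have unitE x : tmap (idlin F) io (tens x (1 : R^o)) =
    \sum_(i < l) tmap (idlin F) (inj l i) (tens x (c i)).
  rewrite tmapE; under eq_bigr do rewrite tmapE.
  rewrite -tens_sumr; congr tens; rewrite mklinE.
  apply: functional_extensionality_dep => i; rewrite dprod_sum (bigD1 i) //=.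
  rewrite mklinE eqxx scale1r big1 ?addr0 // => i' ii'.
  by rewrite mklinE eq_sym (negbTE ii').
have prinj n (i i' : 'I_n) x : pr n i (inj n i' x) = if i == i' then x else 0.
  by rewrite !mklinE.
apply: inj_surj_bij.
  apply: linear_injP => x x0.
  have : tens x (1 : R^o) = 0.
    apply: (linear_inj0 (flat_inj Ff ioI)); rewrite unitE big1 // => i _.
    by rewrite -tens_unitE x0 homf0 linear0.
  move/(congr1 (tlift (mulr_bilinear F) \o tswap _ _)%FUN) => /=.
  by rewrite tswapE tliftE scale1r !linear0.
move=> g; pose w := \sum_(i < l) tmap (idlin F) (inj l i) (homf g (c i)).
have [v vw] : exists v, tmap (idlin F) io v = w.
  apply/ioF; rewrite linear_sum.
  transitivity (\sum_(i < l) \sum_(s < k) tmap (idlin F) (inj k s)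
    (rho s i *: homf g (c i))).
    apply: eq_bigr => i _.
    have [t ->] := tensor_sum (homf g (c i)); rewrite !linear_sum.
    under [RHS]eq_bigr do rewrite scaler_sumr linear_sum.
    rewrite exchange_big; apply: eq_bigr => p _ /=.
    rewrite !tmapE roinj tens_sumr; apply: eq_bigr => s _.
    by rewrite linearZ tmapE tensZr.
  rewrite exchange_big big1 // => s _ /=; rewrite -linear_sum.
  have := congr1 (homf g) (crho s);
    rewrite linear_lin_sys linear0 /lin_sys /= => ->.
  exact: linear0.
have := tensor_R (tswap _ _ v); set x := tlift _ _ => /(congr1 (tswap _ _)).
rewrite tswapK tswapE => vE; exists x; apply: homP;
  apply: (finpres_ext cP) => i.
have := congr1 (tmap (idlin F) (pr l i)) vw.
have prw (h : 'I_l -> tensor F C) :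
    tmap (idlin F) (pr l i) (\sum_(i' < l) tmap (idlin F) (inj l i') (h i')) =
      h i.
  rewrite linear_sum (bigD1 i) //= big1 => [|i' ii']; last first.
    rewrite (@tmap_comp _ _ _ _ _ _ _ _ _ (idlin F) _ _
      (pr l i \o inj l i')%FUN) //.
    by apply: tmap0; right=> y /=; rewrite prinj eq_sym (negbTE ii').
  rewrite addr0 (@tmap_comp _ _ _ _ _ _ _ _ _ (idlin F) _ _
    (pr l i \o inj l i)%FUN) //.
  by apply: tmap_id => // y /=; rewrite prinj eqxx.
by rewrite vE unitE !prw tens_unitE.
Qed.

End Hom.

(** * Proper resolutions and flat resolutions *)

Section Resolutions.
Context (R : comPzRingType).
Implicit Types C F G K M N Y : lmodType R.

(** Flat dimension less than [n]; the value [n = 0] is the zero module. *)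
Definition flat_dim_lt n N := if n is m.+1 then flat_dim_le m N else trivial_mod
  N.

Lemma flat_dim_lt_up n K F N (k : {linear K -> F}) (f : {linear F -> N}) :
  short_exact k f -> flat F -> flat_dim_lt n K -> flat_dim_lt n.+1 N.
Proof.
case: n => [|n] kf Ff; last by move/(flat_dim_leS n kf Ff).
move=> K0; apply/flat_dim_le0; case: kf => _ [kf fS].
apply: flat_iso (inj_surj_bij _ fS) Ff; apply: linear_injP => x /kf[y <-].
by rewrite (K0 y) linear0.
Qed.

Lemma flat_dim_lt_pure n N' N N'' (j : {linear N' -> N})
  (q : {linear N -> N''}) :
  tensor_pure j -> right_exact j q -> flat_dim_lt n N ->
    flat_dim_lt n N' /\ flat_dim_lt n N''.
Proof.
move=> jp jq; case: n => [N0|n Nn]; last first.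
  split=> Q Qn; first exact: tor1_eq0_pure_sub jp (Nn Q Qn).
  exact: tor1_eq0_pure_quot jp jq (Nn Q Qn).
split=> [x|y]; last by have [x <-] := jq.2 y; rewrite (N0 x) linear0.
exact: linear_inj0 (eq_pure_inj (tensor_eq_pure jp)) (N0 _).
Qed.

(** Cut the complex into its syzygies: the last one is zero, and each step back
    raises the flat dimension by at most one. *)
Lemma flat_dim_lt_exact n (G : nat -> lmodType R)
  (d : forall i, {linear G i.+1 -> G i})
    N (aug : {linear G 0 -> N}) :
  (forall i, flat (G i)) -> right_exact (d 0) aug ->
    (forall i, exact (d i.+1) (d i)) ->
  (forall i, n <= i -> trivial_mod (G i))%N -> flat_dim_lt n N.
Proof.
elim: n G d N aug => [|n IH] G d N aug Gf [e0 augS] e G0.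
  by move=> y; have [x <-] := augS y; rewrite (G0 0%N _ x) // linear0.
have dk x : d 0%N x \in kersub aug by apply/mksubE/e0; exists x.
apply: flat_dim_lt_up (short_exact_ker augS) (Gf 0%N) _.
apply: (IH (fun i => G i.+1) (fun i => d i.+1) _ (corestrict dk)) => // [|i ni].
  split=> [x|[x xk]].
    rewrite -(e 0%N x); split=> [/(congr1 (@submod_incl _ _ _))|dx].
      by rewrite corestrictE linear0.
    by apply: submod_incl_inj; rewrite corestrictE dx linear0.
  have /e0 [y yx] : aug x = 0 by apply/(mksubE (ker_submod_pred aug)).
  by exists y; apply: submod_incl_inj; rewrite corestrictE.
exact: G0.
Qed.

(** A flat precover that is the identity when the module is flat already, so
    that iterated kernels stop as soon as the flat dimension allows. *)
Lemma cover_ex N : exists p : {F : lmodType R & {linear F -> N}},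
  [/\ flat (projT1 p),
      forall G (g : {linear G -> N}), flat G ->
        exists h : {linear G -> projT1 p}, forall x, projT2 p (h x) = g x
    & flat N -> injective (projT2 p)].
Proof.
have [Nf|nNf] := pselect (flat N).
  exists (existT (fun F => {linear F -> N}) N (idlin N));
    split=> [|G g _|_ x y] //.
  by exists g.
have [F [f [Ff fP]]] := flat_precover N.
by exists (existT (fun F => {linear F -> N}) F f).
Qed.

Definition cover N := sval (cid (cover_ex N)).
Definition cover_obj N : lmodType R := projT1 (cover N).
Definition cover_map N : {linear cover_obj N -> N} := projT2 (cover N).

Lemma cover_flat N : flat (cover_obj N).
Proof. by case: (svalP (cid (cover_ex N))). Qed.
Lemma cover_lift N G (g : {linear G -> N}) : flat G ->
  exists h : {linear G -> cover_obj N}, forall x, cover_map N (h x) = g x.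
Proof.
by move: g; case: (svalP (cid (cover_ex N))) => _ lft _ g; apply: lft.
Qed.
Lemma cover_inj N : flat N -> injective (cover_map N).
Proof. by case: (svalP (cid (cover_ex N))). Qed.

Lemma cover_surj N : surjective (cover_map N).
Proof.
move=> y; have [h hE] := cover_lift (mklin (scale_linear y)) (@flat_R R).
by exists (h (1 : R^o)); rewrite hE mklinE scale1r.
Qed.

Fixpoint syz N n : lmodType R :=
  if n is m.+1 then submod (kersub (cover_map (syz N m))) else N.

Definition res N n := cover_obj (syz N n).
Definition res_d N n : {linear res N n.+1 -> res N n} :=
  (@submod_incl R _ (kersub (cover_map (syz N n))) \o cover_map
    (syz N n.+1))%FUN.

Lemma cover_res_d N n x : cover_map (syz N n) (res_d N n x) = 0.
Proof. exact/(mksubE (ker_submod_pred (cover_map (syz N n))))/valP. Qed.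

Lemma res_lift N n G (g : {linear G -> res N n}) : flat G ->
  (forall x, cover_map (syz N n) (g x) = 0) ->
  exists h : {linear G -> res N n.+1}, forall x, res_d N n (h x) = g x.
Proof.
move=> Gf g0; have gk x : g x \in kersub (cover_map (syz N n)) by apply/mksubE.
have [h hE] := @cover_lift (syz N n.+1) G (corestrict gk) Gf.
by exists h => x; rewrite /= hE corestrictE.
Qed.

Lemma trivial_cover N : trivial_mod N -> trivial_mod (cover_obj N).
Proof.
by move=> N0 x; apply: (linear_inj0 (cover_inj (flat_trivial N0))); apply: N0.
Qed.

(** Each kernel lowers the flat dimension by one; a flat module is its own
    cover, so its kernel is zero. *)
Lemma flat_dim_lt_syz n N i : flat_dim_lt n N -> flat_dim_lt (n - i) (syz N i).
Proof.
move=> Nn; elim: i => [|i]; first by rewrite subn0.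
have ker0 : flat (syz N i) -> trivial_mod (syz N i.+1).
  move=> Nf x; apply: submod_incl_inj; apply: (linear_inj0 (cover_inj Nf)).
  exact/(mksubE (ker_submod_pred (cover_map (syz N i))))/valP.
rewrite subnS; case: (n - i)%N => [N0|[/flat_dim_le0|m]] //=.
  exact/ker0/flat_trivial.
by move/(flat_dim_leS m (short_exact_ker (@cover_surj _)) (@cover_flat _)).
Qed.

Lemma flat_dim_lt_res n N i : flat_dim_lt n N -> (n <= i)%N ->
  trivial_mod (res N i).
Proof.
move=> Nn ni; apply: trivial_cover.
by have := flat_dim_lt_syz i Nn; rewrite (eqP ni).
Qed.

Section Semidualizing.
Context C l k (c : 'I_l -> C) (rho : 'I_k -> 'I_l -> R) (cP : finpres c rho).
Hypothesis hC : forall f : {linear C -> C}, exists! a : R, f =1 *:%R a.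

(** [C = R (x) C], so properness of a resolution includes exactness of [hom C]
    of it. *)
Lemma in_FC_C : in_FC C C.
Proof.
exists (R^o : lmodType R); first exact: flat_R.
pose e := mklin (@unit_linear2 R (R^o : lmodType R) C (1 : R^o)).
have eE x : e x = tens (1 : R^o) x by exact: mklinE.
exists e, (tlift (mulr_bilinear C)) => [x|u]; rewrite eE -?tensor_R //.
by rewrite tliftE scale1r.
Qed.

Lemma flat_hom_FC Y : in_FC C Y -> flat (hom C Y).
Proof.
case=> F Ff [psi bpsi].
have ub := tens_unit_bij cP hC Ff.
apply: (@flat_iso _ F _ (hom_post C (invlin bpsi) \o tens_unit F C)%FUN) Ff.
apply: bij_comp ub; exists (hom_post C psi) => u; apply: homP => x.
  by rewrite !hom_postE invlinK.
by rewrite !hom_postE invlinKr.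
Qed.

(** Properness against [C] makes [hom C X] exact, and its modules are flat. *)
Lemma proper_flat_dim_lt n M (X : proper_FC_resolution C M) :
  (forall i, n <= i -> trivial_mod (X i))%N -> flat_dim_lt n (hom C M).
Proof.
move=> X0; apply: (@flat_dim_lt_exact n (fun i => hom C (X i))
    (fun i => hom_post C (fc_d X i)) _ (hom_post C (fc_aug X))).
- by move=> i; apply/flat_hom_FC/fc_in_FC.
- split=> [u|u]; last first.
    have [g gE] := fc_proper_aug X in_FC_C (homf u).
    by exists (mkhom g); apply: homP => x; rewrite hom_postE mkhomE.
  split=> [u0|[v <-]]; last by apply: homP => x;
    rewrite !hom_postE homf0 fc_aug_d.
  have [x|g gE] := fc_proper0 in_FC_C (f := homf u).
    by rewrite -hom_postE u0 homf0.
  by exists (mkhom g); apply: homP => x; rewrite hom_postE mkhomE.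
- move=> i u.
  split=> [u0|[v <-]]; last by apply: homP => x;
    rewrite !hom_postE homf0 fc_d_d.
  have [x|g gE] := fc_proper in_FC_C (f := homf u).
    by rewrite -hom_postE u0 homf0.
  by exists (mkhom g); apply: homP => x; rewrite hom_postE mkhomE.
move=> i ni u; apply: homP => x; rewrite homf0; exact: X0.
Qed.

Lemma curry_ex G Y (f : {linear tensor G C -> Y}) :
  exists h : {linear G -> hom C Y}, forall x a, homf (h x) a = f (tens x a).
Proof.
exists (hom_post C f \o tens_unit G C)%FUN => x a /=.
by rewrite hom_postE tens_unitE.
Qed.

Lemma tensor_full F G (f : {linear tensor G C -> tensor F C}) : flat F ->
  exists h : {linear G -> F}, forall u, f u = tmap h (idlin C) u.
Proof.
move=> Ff; have [h hE] := curry_ex f; have ub := tens_unit_bij cP hC Ff.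
exists (invlin ub \o h)%FUN; apply: tensor_ext => x a.
by rewrite tmapE -[RHS]tens_unitE /= invlinK hE.
Qed.

Lemma tens_eq0 F (x : F) : flat F -> (forall a : C, tens x a = 0) -> x = 0.
Proof.
move=> Ff x0; apply: (bij_inj (tens_unit_bij cP hC Ff)); apply: homP => a.
by rewrite tens_unitE linear0 homf0 x0.
Qed.

Section Resolution.
Context (M : lmodType R).
Let N : lmodType R := hom C M.

Lemma aug_bilinear :
  is_bilinear (fun (x : res N 0) (a : C) => homf (cover_map N x) a).
Proof. by split=> [x|a] e u v; rewrite ?linearP // homfD. Qed.
Definition aug : {linear tensor (res N 0) C -> M} := tlift aug_bilinear.

Lemma proper_lift0 Y : in_FC C Y -> forall f : {linear Y -> M},
  exists g : {linear Y -> tensor (res N 0) C}, forall y, aug (g y) = f y.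
Proof.
move=> [G Gf [psi bpsi]] f.
have [h hE] := curry_ex (f \o invlin bpsi)%FUN.
have [h' h'E] := cover_lift h Gf.
exists (tmap h' (idlin C) \o psi)%FUN => y /=.
rewrite -[in RHS](invlinKr bpsi y).
apply: (@tensor_ext _ _ _ _ (aug \o tmap h' (idlin C))%FUN
  (f \o invlin bpsi)%FUN) => x a /=.
by rewrite tmapE tliftE h'E hE.
Qed.

(** Any [f] has the form [h (x) C] up to an isomorphism [psi], and only [h] has
    to be lifted. The vanishing is asked of [h], as it follows from that of
    [f] in different ways for the augmentation and for the differentials. *)
Lemma proper_lift n Y : in_FC C Y ->
  forall f : {linear Y -> tensor (res N n) C},
  (forall G (h : {linear G -> res N n}) (psi : {linear Y -> tensor G C}),
    (forall y, f y = tmap h (idlin C) (psi y)) -> surjective psi ->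
    forall x, cover_map (syz N n) (h x) = 0) ->
  exists g : {linear Y -> tensor (res N n.+1) C},
    forall y, tmap (res_d N n) (idlin C) (g y) = f y.
Proof.
move=> [G Gf [psi bpsi]] f f0.
have [h hE] := tensor_full (f \o invlin bpsi)%FUN (@cover_flat (syz N n)).
have fh y : f y = tmap h (idlin C) (psi y) by rewrite -hE /= invlinKr.
have psiS : surjective psi by move=> u; exists (invlin bpsi u); rewrite invlinK.
have [h' h'E] := res_lift Gf (f0 G h psi fh psiS).
exists (tmap h' (idlin C) \o psi)%FUN => y.
by rewrite fh; apply: tmap_comp.
Qed.

Lemma res_d_d n u :
  tmap (res_d N n) (idlin C) (tmap (res_d N n.+1) (idlin C) u) = 0.
Proof.
rewrite (@tmap_comp _ _ _ _ _ _ _ _ _ (res_d N n \o res_d N n.+1)%FUN _ _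
  (idlin C)) //.
by apply: tmap0; left=> y;
  rewrite -[LHS]/(submod_incl (cover_map (syz N n.+1) (res_d N n.+1 y)))
  cover_res_d linear0.
Qed.

Lemma aug_d u : aug (tmap (res_d N 0) (idlin C) u) = 0.
Proof.
have [s ->] := tensor_sum u; rewrite !linear_sum big1 // => p _.
by rewrite tmapE tliftE (@cover_res_d N 0%N) homf0.
Qed.

Lemma proper_lift_aug Y : in_FC C Y ->
  forall f : {linear Y -> tensor (res N 0) C},
  (forall y, aug (f y) = 0) ->
  exists g : {linear Y -> tensor (res N 1) C},
    forall y, tmap (res_d N 0) (idlin C) (g y) = f y.
Proof.
move=> Yfc f f0; apply: proper_lift => // G h psi fh psiS x.
apply: homP => a; have [y yx] := psiS (tens x a).
by have := f0 y; rewrite fh yx tmapE tliftE homf0.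
Qed.

Lemma proper_lift_d n Y : in_FC C Y ->
  forall f : {linear Y -> tensor (res N n.+1) C},
  (forall y, tmap (res_d N n) (idlin C) (f y) = 0) ->
  exists g : {linear Y -> tensor (res N n.+2) C},
    forall y, tmap (res_d N n.+1) (idlin C) (g y) = f y.
Proof.
move=> Yfc f f0; apply: proper_lift => // G h psi fh psiS x.
apply: submod_incl_inj; apply: (tens_eq0 (@cover_flat (syz N n))) => a.
have [y yx] := psiS (tens x a).
by have := f0 y; rewrite fh yx !tmapE.
Qed.

Lemma res_in_FC n : in_FC C (tensor (res N n) C).
Proof.
exists (res N n); first exact: cover_flat.
by exists (idlin _); exists id.
Qed.

Definition resolution : proper_FC_resolution C M :=
  ProperFCResolution res_in_FC res_d_d aug_d proper_lift0 proper_lift_aug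
    proper_lift_d.

Lemma resolution_trivial n i :
  flat_dim_lt n N -> (n <= i)%N -> trivial_mod (resolution i).
Proof.
move=> Nn ni u; rewrite -[u](@tmap_id _ _ _ (idlin _) (idlin _)) //.
by apply: tmap0; left; apply: flat_dim_lt_res ni.
Qed.
End Resolution.

(** If [X] vanishes from degree [n] on, then so does the resolution of [M2]: in
    each degree where the latter is not zero, some later or equal degree of [X]
    is not zero. *)
Lemma FC_pd_le M M2 :
  (forall n, flat_dim_lt n (hom C M) -> flat_dim_lt n (hom C M2)) ->
    (FC_pd C M2 <= FC_pd C M)%E.
Proof.
move=> fdM; apply: le_ereal_inf_tmp => _ [X ->].
apply: (@le_trans _ _ (fc_length (resolution M2))).
  by apply: ereal_inf_lbound; exists (resolution M2).
apply: ub_ereal_sup => _ [n [x x0] <-].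
have [j [nj [y y0]]] : exists j, (n <= j)%N /\ exists y : X j, y <> 0.
  apply: contrapT => nX; apply: x0.
  apply: (@resolution_trivial M2 n n) => //; apply: fdM.
  apply: (@proper_flat_dim_lt _ _ X) => j nj y; apply: contrapT => y0.
  by apply: nX; exists j; split=> //; exists y.
apply: (@le_trans _ _ (j%:R%:E)); first by rewrite lee_fin ler_nat.
by apply: ereal_sup_ubound; exists j => //; exists y.
Qed.

End Semidualizing.
End Resolutions.

Theorem theorem4 (R : comPzRingType) (C M : lmodType R) (M' : submodClosed M) :
  noetherian R -> semidualizing C -> pure M' ->
  (FC_pd C M >=
     ereal_sup [set FC_pd C (submod M'); FC_pd C (quotmod M') - 1]%classic)%E.
Proof.
move=> nR [fgC homC _] pM.
have [l [k [c [rho cP]]]] := noetherian_finpres nR fgC.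
have jp : eq_pure (@submod_incl R M M').
  by apply: tensor_eq_pure => X; apply/tens_map_injE/pM.
have jq : right_exact (@submod_incl R M M') (quotmod_proj M').
  split; last exact: quotmod_proj_surj.
  move=> b; rewrite quotmod_proj_eq0; split=> [bM|[a <-]]; last exact: valP.
  by exists (Submod bM).
have fd n := @flat_dim_lt_pure R n _ _ _ _ _
  (eq_tensor_pure (hom_post_eq_pure cP jp)) (hom_post_right_exact cP jp jq).
apply: ub_ereal_sup => _ [->|->].
  by apply: (FC_pd_le cP homC) => n /fd[].
apply: (@le_trans _ _ (FC_pd C (quotmod M'))).
  by rewrite leeBlDr // leeDl.
by apply: (FC_pd_le cP homC) => n /fd[].
Qed.
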